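(* Let $M=\mathbb{Q}(\sqrt{6})$ with ring of integers $\mathcal{O}_M$, and let $|q|<1$. Define \[ L_{9}(q) := \sum_{n \geq 1}\sum_{k=1}^{n} \frac{(-1)_n (q)_{n-1}(-1)^{n+k}q^{n + \binom{k+1}{2}} }{(q)_{n-k} (q)_{k-1} (1-q^{2k-1})},\qquad L_{10}(q) := q \sum_{n \geq 1} \sum_{k=1}^{n} \frac{(-1)_n (q)_{n-1}(-1)^{n+k}q^{n + \binom{k}{2}} }{(q)_{n-k} (q)_{k-1} (1-q^{2k-1})}, \] \[ L_{11}(q) := 2 {\sum_{n \geq 0}}^{*}\sum_{k=0}^{n} \frac{(q^2; q^2)_{n}(-1)^{n+k}q^{\binom{k+1}{2}} }{(q)_{n-k} (q)_{k} (1-q^{2k+1})},\qquad L_{12}(q) := -2 + 2 {\sum_{n \geq 0}}^{*}\sum_{k=0}^{n} \frac{(q^2; q^2)_{n}(-1)^{n+k}q^{\binom{k}{2}} }{(q)_{n-k} (q)_{k} (1-q^{2k+1})}. \] Then \[ q^{-9} L_{9}(q^{16}) = \sum_{\substack{\mathfrak{a} \subset \mathcal{O}_{M} \\ N(\mathfrak{a}) \equiv 7 \pmod{16}}} q^{N(\mathfrak{a})},\qquad q^{-17} L_{10}(q^{16}) = \sum_{\substack{\mathfrak{a} \subset \mathcal{O}_{M} \\ N(\mathfrak{a}) \equiv 15 \pmod{16}}} q^{N(\mathfrak{a})}, \] \[ q^{5} L_{11}(q^{48}) = \frac{1}{2} \sum_{\substack{\mathfrak{a} \subset \mathcal{O}_{M}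 \\ N(\mathfrak{a}) \equiv 5 \pmod{48}}} q^{N(\mathfrak{a})},\qquad q^{-19} L_{12}(q^{48}) = \frac{1}{2} \sum_{\substack{\mathfrak{a} \subset \mathcal{O}_{M} \\ N(\mathfrak{a}) \equiv 29 \pmod{48}}} q^{N(\mathfrak{a})}. \]
   Context: For $n\in\mathbb{N}\cup\{\infty\}$, $(a)_n=(a;q)_n=\prod_{k=1}^{n}(1-aq^{k-1})$ (empty product $=1$), and $(a;q^2)_n$ is defined likewise with $q$ replaced by $q^2$. The notation ${\sum_{n\ge 0}}^{*} c_n$ denotes the value defined as the average of the even and odd partial sums, i.e. $\lim_{N\to\infty}\frac12\left(\sum_{n=0}^{2N}c_n+\sum_{n=0}^{2N+1}c_n\right)$ (the series need not converge classically). The sums on the right run over nonzero ideals $\mathfrak{a}$ of $\mathcal{O}_M$ with the given congruence condition on the absolute norm $N(\mathfrak{a})$, each ideal counted once. *)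

(* Defs.v *)
From HB Require Import structures.
From mathcomp Require Import all_boot all_order all_algebra finmap.
From mathcomp Require Import all_classical all_reals all_analysis.
From mathcomp Require Import complex.
Import numFieldNormedType.Exports.

Set Implicit Arguments.
Unset Strict Implicit.
Unset Printing Implicit Defensive.

Import Order.TTheory GRing.Theory Num.Theory.
Local Open Scope ring_scope.
Local Open Scope classical_set_scope.

(* Since 6 = 2 mod 4, O_M = Z[sqrt 6]; the element a + b sqrt 6 is encoded by
   the pair (a, b) : int * int (addition/subtraction are componentwise). *)
Definition OM := (int * int)%type.

Definition OM_mul (x y : OM) : OM :=
  (x.1 * y.1 + 6 * (x.2 * y.2), x.1 * y.2 + x.2 * y.1).

Definition is_ideal (I : set OM) : Prop :=
  I 0 /\ (forall x y, I x -> I y -> I (x - y)) /\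
  (forall r x, I x -> I (OM_mul r x)).

Definition nonzero_ideal (I : set OM) : Prop :=
  is_ideal I /\ exists x, x != 0 /\ I x.

(* absolute norm: N(I) = n  iff  the quotient ring O_M / I has exactly n elements,
   i.e. there is a surjection O_M ->> 'I_n whose fibres are the cosets of I. *)
Definition ideal_norm_is (I : set OM) (n : nat) : Prop :=
  exists f : OM -> 'I_n, (forall j : 'I_n, exists x, f x = j) /\
    (forall x y, f x = f y <-> I (x - y)).

Definition num_ideals (n : nat) : nat :=
  (#|` fset_set [set I : set OM | nonzero_ideal I /\ ideal_norm_is I n] |)%fset.

(* coefficient of q^n in  sum_{a, N(a) = r mod m} q^{N(a)} *)
Definition ideal_coef (m r n : nat) : nat :=
  if (n %% m == r %% m)%N then num_ideals n else 0%N.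

Section Cx.
Variable R : realType.
Local Notation C := R[i].

Definition cconv (u : nat -> C) (l : C) : Prop :=
  (fun N => Normc.normc (u N - l)) @ \oo --> (0 : R).

Definition csums (u : nat -> C) (l : C) : Prop :=
  cconv (fun N => \sum_(n < N) u n) l.

Definition cstarsums (u : nat -> C) (l : C) : Prop :=
  cconv (fun N => (\sum_(n < N.*2.+1) u n + \sum_(n < N.*2.+2) u n) / 2) l.

Definition qpoch (a q : C) (n : nat) : C := \prod_(k < n) (1 - a * q ^+ k).

Definition term910 (e : nat -> nat) (q : C) (n : nat) : C :=
  \sum_(1 <= k < n.+1)
    (qpoch (-1) q n * qpoch q q n.-1 * (-1) ^+ (n + k)%N * q ^+ (n + e k)%N) /
    (qpoch q q (n - k)%N * qpoch q q k.-1 * (1 - q ^+ (2 * k)%N.-1)).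

Definition term1112 (e : nat -> nat) (q : C) (n : nat) : C :=
  \sum_(0 <= k < n.+1)
    (qpoch (q ^+ 2) (q ^+ 2) n * (-1) ^+ (n + k)%N * q ^+ (e k)) /
    (qpoch q q (n - k)%N * qpoch q q k * (1 - q ^+ (2 * k)%N.+1)).

Definition L9_is (q l : C) : Prop :=
  csums (fun n => term910 (fun k => 'C(k.+1, 2)) q n.+1) l.
Definition L10_is (q l : C) : Prop :=
  exists s, csums (fun n => term910 (fun k => 'C(k, 2)) q n.+1) s /\ l = q * s.
Definition L11_is (q l : C) : Prop :=
  exists s, cstarsums (term1112 (fun k => 'C(k.+1, 2)) q) s /\ l = 2 * s.
Definition L12_is (q l : C) : Prop :=
  exists s, cstarsums (term1112 (fun k => 'C(k, 2)) q) s /\ l = -2 + 2 * s.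

Definition ideal_sum_is (m r : nat) (q S : C) : Prop :=
  csums (fun n => (ideal_coef m r n)%:R * q ^+ n) S.

End Cx.

(* Main.v *)
(* Put q = p^2.  Since 1 / (1 - X^2) and X / (1 - X^2) are the even and odd parts of
   1 / (1 - X), the four double sums are even or odd parts in p of two double sums
     sum_n (q^2; q^2)_n (-q^e)^n beta_n,   e = 0, 1,
   where beta_n = sum_l (-1)^l q^C(l+1,2) / ((q)_(n-l) (q)_l (1 - p^(2l+1))).
   Inverting the Bailey transform gives the sequence alpha attached to beta relative to
   a = q^(e+1); it satisfies two-step recurrences in which 1 - p^(2l+1) cancels, and so
   collapses to (-1)^s times a finite sum of powers of p.  The double sums thereby become
   indefinite theta series.  With p = q^24 (e = 0) or p = q^8 (e = 1) their exponents are
   8u^2 - 3v^2 with 3|v| < 4u, resp. 24z^2 - v^2 with |v| < 4z: up to a change of variables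
   these are 6y^2 - x^2 on a fundamental domain for the action of the unit 5 + 2 sqrt 6, so
   they count the ideals of the principal ideal domain Z[sqrt 6] of the given norm. *)
Require Import Defs.
From HB Require Import structures.
From mathcomp Require Import all_boot all_order all_algebra finmap.
From mathcomp Require Import all_classical all_reals all_analysis.
From mathcomp Require Import complex ring lra zify.
Import numFieldNormedType.Exports.
Import Order.TTheory GRing.Theory Num.Theory.
Local Open Scope ring_scope.

Set Implicit Arguments.
Unset Strict Implicit.
Unset Printing Implicit Defensive.

(** The obstacle is convergence. For e = 0 the series that would define gamma has terms that do not
    tend to 0, so the transform is carried out exactly at a finite cutoff N and the error is
    estimated afterwards. Three sizes have to match. The value alpha_s is O(s |q|^s), because its
    smallest exponent of p is s^2 + s >= 2s. The truncated gamma_s deviates from its ideal value,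
    (-1)^s / 2 for e = 0 and (-1)^s / (q^(-s) - q^(s+2)) for e = 1, by O(s |q|^(N-s)); for e = 0
    this holds only after averaging two consecutive cutoffs, which is what the starred sum provides.
    The products are O(s^2 |q|^N), and the total error O(N^3 |q|^N). The sign of alpha_s cancels
    that of gamma_s, so the theta series have positive coefficients and can count ideals. On the
    arithmetic side only elements of norm -n are needed: an odd value of x^2 - 6y^2 is 1 or 3 mod 8,
    whereas n is 7 or 5 mod 8. *)

Definition qprod (F : fieldType) (a q : F) (n : nat) : F :=
  \prod_(k < n) (1 - a * q ^+ k).

(* 1 / (q; q)_(m - s), read as 0 for s > m. *)
Definition inv_qfact (F : fieldType) (q : F) (m s : nat) : F :=
  if (s <= m)%N then (qprod q q (m - s))^-1 else 0.

Lemma binD2 a b : 'C(a + b, 2) = ('C(a, 2) + 'C(b, 2) + a * b)%N.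
Proof.
elim: b => [|b IH]; first by rewrite addn0 muln0 !addn0.
by rewrite addnS !binS !bin1 IH; lia.
Qed.

Lemma bin2D n : (n + 2 * 'C(n, 2) = n ^ 2)%N.
Proof. by elim: n => // n IH; rewrite binS bin1; nia. Qed.

(** * Bailey pairs *)

Section QSeries.
Variables (F : fieldType) (q : F).
Hypothesis q0 : q != 0.
Hypothesis q1 : forall k, 1 - q ^+ k.+1 != 0.

Local Notation f := (qprod q q).
Local Notation jf := (inv_qfact q).

Local Ltac at_field :=
  match goal with |- @eq _ ?a ?b => change (@eq (GRing.Field.sort F) a b) end.

Lemma qprod0 (a r : F) : qprod a r 0 = 1.
Proof. by rewrite /qprod big_ord0. Qed.

Lemma qprodS (a r : F) n : qprod a r n.+1 = qprod a r n * (1 - a * r ^+ n).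
Proof. by rewrite /qprod big_ord_recr. Qed.

Lemma qprodSl (a r : F) n : qprod a r n.+1 = (1 - a) * qprod (a * r) r n.
Proof.
rewrite /qprod big_ord_recl expr0 mulr1; congr (_ * _).
by apply: eq_bigr => i _; rewrite /= /bump /= add1n exprS mulrA.
Qed.

Lemma qprodD (a r : F) m n :
  qprod a r (m + n) = qprod a r m * qprod (a * r ^+ m) r n.
Proof.
elim: n => [|n IH]; first by rewrite addn0 qprod0 mulr1.
by rewrite addnS !qprodS IH exprD !mulrA.
Qed.

Lemma qfactS n : f n.+1 = f n * (1 - q ^+ n.+1).
Proof. by rewrite qprodS exprS. Qed.

Lemma qfact_neq0 n : f n != 0.
Proof.
elim: n => [|n IH]; first by rewrite qprod0 oner_neq0.
by rewrite qfactS mulf_neq0.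
Qed.

Lemma qfactD m n : f (m + n) = f m * qprod (q ^+ m.+1) q n.
Proof. by rewrite qprodD exprS. Qed.

Lemma inv_qfactS m s : jf m.+1 s * (1 - q ^+ (m.+1 - s)) = jf m s.
Proof.
rewrite /inv_qfact; case: (ltngtP s m.+1) => [sm|sm|->].
- rewrite -ltnS sm subSn // qfactS invfM -mulrA mulVf ?mulr1 //; exact: q1.
- by rewrite leqNgt ltnW // mul0r.
- by rewrite subnn expr0 subrr mulr0 ltnn.
Qed.

Lemma inv_qfactSS m s : jf m.+1 s.+1 = jf m s.
Proof. by rewrite /inv_qfact ltnS subSS. Qed.

Lemma inv_qfact_small m s : (m < s)%N -> jf m s = 0.
Proof. by move=> ms; rewrite /inv_qfact leqNgt ms. Qed.

Lemma inv_qfactE m s : (s <= m)%N -> jf m s = (f (m - s))^-1.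
Proof. by rewrite /inv_qfact => ->. Qed.

Lemma sum_inv_qfactS m (G : nat -> F) :
  \sum_(l < m.+2) G l * jf m l = \sum_(l < m.+1) G l * jf m l.
Proof. by rewrite big_ord_recr /= inv_qfact_small // mulr0 addr0. Qed.

(** Split 1 - q^(N+1) as (1 - q^(N+1-l)) + q^(N+1-l) (1 - q^l). The first part gives B times the sum
    for B at N, the second 1 - B times the sum for B q at N; hence the induction is uniform in B. *)
Lemma qVandermonde (B : F) N :
  \sum_(l < N.+1) qprod B q l * B ^+ (N - l) / f l * jf N l = (f N)^-1.
Proof.
elim: N B => [|N IH] B.
  by rewrite big_ord1 inv_qfactE // subnn !qprod0 expr0 mulr1 invr1 !mulr1.
apply: (mulfI (q1 N)); rewrite qfactS invfM mulrCA mulfV ?mulr1 ?q1 //.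
pose G N l := qprod B q l * B ^+ (N - l) / f l.
have -> : (1 - q ^+ N.+1) *
    \sum_(l < N.+2) qprod B q l * B ^+ (N.+1 - l) / f l * jf N.+1 l =
    B * (\sum_(l < N.+2) G N l * jf N l) +
    \sum_(l < N.+2) q ^+ (N.+1 - l) * (1 - q ^+ l) * (G N.+1 l * jf N.+1 l).
  rewrite !mulr_sumr -big_split; apply: eq_bigr => -[l lN] _ /=.
  have -> : q ^+ N.+1 = q ^+ (N.+1 - l) * q ^+ l by rewrite -exprD subnK.
  have -> : B * (G N l * jf N l) = G N.+1 l * jf N l.
    rewrite /G; move: lN; rewrite ltnS leq_eqVlt => /orP[/eqP->|lN]; last first.
      by rewrite subSn // exprS; at_field; ring.
    by rewrite inv_qfact_small // !mulr0.
  by rewrite -(inv_qfactS N l) /G; at_field; ring.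
rewrite sum_inv_qfactS IH big_ord_recl expr0 subrr mulr0 mul0r add0r.
have -> : \sum_(i < N.+1) q ^+ (N.+1 - lift ord0 i) * (1 - q ^+ lift ord0 i) *
      (G N.+1 (lift ord0 i) * jf N.+1 (lift ord0 i)) = (1 - B) / f N.
  rewrite -(IH (B * q)) mulr_sumr; apply: eq_bigr => -[l lN] _ /=.
  rewrite /bump /= add1n inv_qfactSS /G subSS qprodSl qfactS exprMn invfM.
  have h := q1 l; have h2 := qfact_neq0 l.
  by at_field; field; rewrite h h2.
by rewrite -mulrDl addrC subrK mul1r.
Qed.

(** The q-binomial expansion of (1; q)_N divided by (q; q)_N. Its value at N = 0 is what the
    constant -2 in L_12 compensates. *)
Lemma finite_euler N :
  \sum_(l < N.+1) (-1) ^+ l * q ^+ 'C(l, 2) / f l * jf N l = (N == 0%N)%:R.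
Proof.
case: N => [|N].
  by rewrite big_ord1 inv_qfactE // subnn !qprod0 !expr0 invr1 !mulr1.
apply: (mulfI (q1 N)); rewrite /= mulr0.
pose G l := (-1) ^+ l * q ^+ 'C(l, 2) / f l.
(* Telescoping certificate; it vanishes at l = 0 through 1 - q^l and at l = N+2 through
   [inv_qfact]. *)
pose H l := - (1 - q ^+ l) * (G l * jf N.+1 l).
have HS l : (l < N.+2)%N ->
   (1 - q ^+ N.+1) * (G l * jf N.+1 l) = H l.+1 - H l.
  move=> lN.
  have -> : q ^+ N.+1 = q ^+ (N.+1 - l) * q ^+ l by rewrite -exprD subnK.
  rewrite /H inv_qfactSS -(inv_qfactS N l) /G binS bin1 exprD !exprS qfactS exprS.
  have h := q1 l; have h2 := qfact_neq0 l.
  by rewrite exprS in h; at_field; field; rewrite h h2.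
rewrite mulr_sumr (eq_bigr (fun l : 'I_N.+2 => H l.+1 - H l)); last first.
  by move=> [l lN] _; apply: HS.
rewrite -(big_mkord predT (fun l => H l.+1 - H l)) telescope_sumr //.
by rewrite /H inv_qfact_small // expr0 subrr oppr0 !mulr0 mul0r subrr.
Qed.

Lemma sum_ord_telescope (G H : nat -> F) N :
  (forall i, (i < N)%N -> G i = H i.+1 - H i) -> \sum_(i < N) G i = H N - H 0%N.
Proof.
move=> GH; rewrite -(telescope_sumr H (leq0n N)) big_mkord.
by apply: eq_bigr => -[i iN] _; apply: GH.
Qed.

(* A terminating very-well-poised sum; H is its WZ certificate in M. *)
Lemma bailey_orthogonality (A : F) M : (forall k, 1 - A * q ^+ k != 0) ->
  \sum_(i < M.+1) (-1) ^+ i * A ^+ i * q ^+ (i ^ 2 + 'C(i, 2)) *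
     (1 - A * q ^+ i.*2) * qprod A q i / f i / qprod A q (M + i).+1 * jf M i
  = (f M)^-1.
Proof.
move=> A1.
have A0 n : qprod A q n != 0.
  elim: n => [|n IH]; first by rewrite qprod0 oner_neq0.
  by rewrite qprodS mulf_neq0.
pose X i : F := (-1) ^+ i * A ^+ i * q ^+ (i ^ 2 + 'C(i, 2)) * qprod A q i / f i.
pose T M i : F := X i * (1 - A * q ^+ i.*2) / qprod A q (M + i).+1.
have -> : \sum_(i < M.+1) (-1) ^+ i * A ^+ i * q ^+ (i ^ 2 + 'C(i, 2)) *
     (1 - A * q ^+ i.*2) * qprod A q i / f i / qprod A q (M + i).+1 * jf M i
     = \sum_(i < M.+1) T M i * jf M i.
  by apply: eq_bigr => i _; congr (_ * _); rewrite /T /X; at_field; ring.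
elim: M => [|M IH].
  rewrite big_ord1 inv_qfactE // subnn /T /X !qprodS !qprod0 bin0n double0 /=.
  have := A1 0%N; rewrite expr0 mulr1 => h.
  by at_field; field; rewrite h oner_neq0.
pose H i : F := - (q ^+ M.+1 / q ^+ i) * X i * (1 - q ^+ i) * f M * jf M.+1 i /
  qprod A q (M + i).+1.
pose D i : F := f M.+1 * (T M.+1 i * jf M.+1 i) - f M * (T M i * jf M i).
have E : \sum_(i < M.+2) D i = H M.+2 - H 0%N.
  apply: (@sum_ord_telescope D H) => i iM.
  have qi0 : q ^+ i != 0 by rewrite expf_neq0.
  have eQ : q ^+ M.+1 = q ^+ (M.+1 - i) * q ^+ i by rewrite -exprD subnK.
  have e1 : X i.+1 = - X i * A * q ^+ i ^+ 3 * q * (1 - A * q ^+ i) / (1 - q * q ^+ i).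
    rewrite /X qprodS qfactS binS bin1.
    have -> : (i.+1 ^ 2 + ('C(i, 2) + i) = i ^ 2 + 'C(i, 2) + (i + i + i).+1)%N.
      by rewrite -addn1 sqrnD; lia.
    have h := q1 i; have h2 := qfact_neq0 i; rewrite exprS in h.
    by rewrite !exprS !exprD !exprS !exprD; at_field; field; rewrite h h2.
  have AM := A1 (M + i).+1.
  have eM : q ^+ (M + i).+1 = q ^+ (M.+1 - i) * q ^+ i * q ^+ i.
    by rewrite -addSn exprD eQ.
  have h := q1 i; rewrite exprS in h; rewrite eM in AM.
  have hW := A0 (M + i).+1.
  rewrite /D /H inv_qfactSS -(inv_qfactS M i) /T e1 qfactS.
  rewrite addSn addnS (qprodS A q (M + i).+1) eM eQ [q ^+ i.+1]exprS -addnn exprD.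
  move: (X i) (jf M.+1 i) (f M) (qprod A q (M + i).+1) (q ^+ i) (q ^+ (M.+1 - i)) hW qi0 h AM.
  move=> x u z w y Z *; at_field; field.
  by do ?[apply/andP; split].
have H0 : H 0%N = 0 by rewrite /H expr0 subrr mulr0 !mul0r.
have H2 : H M.+2 = 0 by rewrite /H inv_qfact_small // mulr0 mul0r.
move: E; rewrite H0 H2 subrr sumrB -!mulr_sumr sum_inv_qfactS IH mulfV ?qfact_neq0 //.
move/subr0_eq => E; apply: (mulfI (qfact_neq0 M.+1)).
by rewrite E mulfV ?qfact_neq0.
Qed.

Definition bailey_coef (e s l : nat) : F :=
  (-1) ^+ (s - l) * q ^+ ((l.*2 + e.+1) * (s - l) + (s - l) ^ 2 + 'C(s - l, 2)) *
  (1 - q ^+ (s.*2 + e.+1)) * f (s + l + e) * jf s l.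

(** Only l <= s <= m contribute; with s = i + l the sum is that of [bailey_orthogonality] for A =
    q^(2l+e+1) and M = m - l. *)
Lemma bailey_inversion e l m N : (m < N)%N ->
  jf m l = \sum_(s < N) bailey_coef e s l * (jf m s / f (m + s + e.+1)).
Proof.
move=> mN.
pose G s := bailey_coef e s l * (jf m s / f (m + s + e.+1)).
rewrite -(big_mkord predT G) (big_cat_nat (n := m.+1)) //=.
rewrite [X in _ + X]big_nat_cond [X in _ + X]big1 ?addr0; last first.
  by move=> s /andP[/andP[ms _] _]; rewrite /G (inv_qfact_small ms) mul0r mulr0.
case: (ltnP m l) => [ml|lm].
  rewrite inv_qfact_small // big_nat_cond big1 // => s /andP[/andP[_ sm] _].
  by rewrite /G /bailey_coef (@inv_qfact_small s l) ?mulr0 ?mul0r // (leq_ltn_trans _ ml).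
rewrite (big_cat_nat (n := l)) //=; last exact: leqW.
rewrite big_nat_cond big1 ?add0r; last first.
  move=> s /andP[/andP[_ sl] _].
  by rewrite /G /bailey_coef (@inv_qfact_small s l) ?mulr0 ?mul0r.
rewrite -[X in \sum_(X <= _ < _) _](add0n l) big_addn subSn // big_mkord inv_qfactE //.
set M := (m - l)%N; set A := q ^+ (l.*2 + e).+1.
have A1 k : 1 - A * q ^+ k != 0 by rewrite -exprD addSn.
rewrite -(bailey_orthogonality M A1); apply: eq_bigr => -[i iM] _ /=.
rewrite /G /bailey_coef addnK.
have -> : (m + (i + l) + e.+1 = l.*2 + e + (M + i).+1)%N by rewrite /M; lia.
have -> : (i + l + l + e = l.*2 + e + i)%N by lia.
rewrite !qfactD -/A.
have -> : jf m (i + l) = jf M i.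
  rewrite /M in iM *; rewrite !inv_qfactE; try lia.
  by congr (f _)^-1; lia.
rewrite (@inv_qfactE (i + l)) ?leq_addl // addnK.
have -> : ((l.*2 + e.+1) * i + i ^ 2 + 'C(i, 2) = (l.*2 + e).+1 * i + (i ^ 2 + 'C(i, 2)))%N
  by rewrite addnS addnA.
have -> : ((i + l).*2 + e.+1 = (l.*2 + e).+1 + i.*2)%N by lia.
rewrite [q ^+ (_ * i + _)]exprD (exprM q) [q ^+ (_ + i.*2)]exprD -/A.
have /andP[h1 h1'] : (f l.*2 != 0) && (qprod (q ^+ l.*2.+1) q e != 0).
  by rewrite -negb_or -mulf_eq0 -qfactD qfact_neq0.
have h2 := qfact_neq0 i.
have h3 : qprod A q (M + i).+1 != 0.
  by move: (qfact_neq0 ((l.*2 + e) + (M + i).+1)); rewrite qfactD -/A mulf_eq0 negb_or => /andP[].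
by at_field; field; rewrite h1 h1' h2 h3.
Qed.

(** Bailey's transform cut off at N: [bailey_inversion] followed by an exchange of finite sums, so
    no convergence enters. The inner sum over m is the truncated gamma. *)
Lemma bailey_transform e (c delta : nat -> F) N :
  \sum_(m < N) delta m * (\sum_(l < m.+1) c l * jf m l) =
  \sum_(s < N) (\sum_(l < s.+1) c l * bailey_coef e s l) *
     \sum_(m < N) delta m * (jf m s / f (m + s + e.+1)).
Proof.
have widen (g : nat -> F) m : (m < N)%N -> (forall l, (m < l)%N -> g l = 0) ->
    \sum_(l < m.+1) g l = \sum_(l < N) g l.
  move=> mN g0; rewrite -!(big_mkord predT g) [RHS](big_cat_nat (n := m.+1)) //=.
  rewrite [X in _ = _ + X]big_nat_cond [X in _ = _ + X]big1 ?addr0 //.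
  by move=> l /andP[/andP[ml _] _]; apply: g0.
transitivity (\sum_(m < N) \sum_(l < N) \sum_(s < N)
   c l * bailey_coef e s l * (delta m * (jf m s / f (m + s + e.+1)))).
  apply: eq_bigr => -[m mN] _ /=.
  rewrite (widen (fun l => c l * jf m l)) //; last first.
    by move=> l ml; rewrite inv_qfact_small ?mulr0.
  rewrite mulr_sumr; apply: eq_bigr => -[l lN] _ /=.
  rewrite (bailey_inversion e l mN) !mulr_sumr; apply: eq_bigr => s _ /=.
  by at_field; ring.
rewrite [RHS](eq_bigr (fun s : 'I_N => \sum_(m < N) \sum_(l < N)
   c l * bailey_coef e s l * (delta m * (jf m s / f (m + s + e.+1))))); last first.
  move=> [s sN] _ /=; rewrite (widen (fun l => c l * bailey_coef e s l)) //; last first.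
    by move=> l sl; rewrite /bailey_coef inv_qfact_small ?mulr0.
  by rewrite mulr_sumr; apply: eq_bigr => m _; rewrite mulr_suml.
rewrite [RHS]exchange_big; apply: eq_bigr => m _; exact: exchange_big.
Qed.

(** * Closed form of alpha *)

Section ClosedForm.
Variable p : F.
Hypothesis pq : p ^+ 2 = q.
Hypothesis p1 : forall k, 1 - p ^+ k.+1 != 0.

Let p0 : p != 0. Proof. by apply: contraNneq q0 => e; rewrite -pq e expr0n. Qed.

(** What remains of alpha after extracting the sign, the factor 1 - q^(2s+e+1) and a power of q
    depending on s and e only; see [bailey_alpha_kernel]. *)
Definition half_kernel (e s : nat) : F :=
  \sum_(l < s.+1) f (s + l + e) / q ^+ ((s + e) * l) / (f l * (1 - p ^+ l.*2.+1)) * jf s l.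

(** This is [qVandermonde] at B = q^(n+1), because f (n + l) = f n (B; q)_l. It evaluates the
    inhomogeneous terms of both recurrences. *)
Lemma sum_qfact n :
  \sum_(l < n.+1) f (n + l) / q ^+ (n.+1 * l) / f l * jf n l = (q ^+ (n * n.+1))^-1.
Proof.
have h := qVandermonde (q ^+ n.+1) n.
have B0 : q ^+ n.+1 != 0 by rewrite expf_neq0.
apply: (@mulfI _ (q ^+ n.+1 ^+ n / f n)).
  by rewrite mulf_neq0 ?invr_eq0 ?expf_neq0 ?qfact_neq0.
have -> : q ^+ (n * n.+1) = q ^+ n.+1 ^+ n by rewrite -exprM mulnC.
rewrite [RHS]mulrAC mulfV ?expf_neq0 // mul1r -[RHS]h mulr_sumr.
apply: eq_bigr => -[l ln] _ /=; rewrite ltnS in ln.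
have -> : q ^+ n.+1 ^+ n = q ^+ n.+1 ^+ (n - l) * q ^+ n.+1 ^+ l by rewrite -exprD subnK.
rewrite qfactD exprM.
have h1 : q ^+ n.+1 ^+ l != 0 by rewrite !expf_neq0.
have h2 := qfact_neq0 n; have h3 := qfact_neq0 l.
move: (q ^+ n.+1 ^+ l) h1 => Z h1.
by at_field; field; rewrite h1 h2 h3.
Qed.

(* With X = p^(2l+1), the l-th summands of the two sides differ by a multiple of 1 - X,
   which cancels their denominator. *)
Lemma half_kernel_step0 s :
  half_kernel 1 s = p * ((1 - p ^+ s.*2.+1) * half_kernel 0 s) + (q ^+ (s * s.+1))^-1.
Proof.
rewrite -sum_qfact /half_kernel !mulr_sumr -big_split; apply: eq_bigr => -[l ls] _ /=.
have h1 := qfact_neq0 l; have h2 := p1 l.*2.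
have h3 : q ^+ l != 0 by rewrite expf_neq0.
have h4 : q ^+ s ^+ l != 0 by rewrite !expf_neq0.
rewrite addn0 !addn1 addn0 qfactS mulSn exprD exprM.
have -> : q ^+ (s + l).+1 = p ^+ s.*2.+1 * p ^+ l.*2.+1.
  by rewrite -exprD -pq -exprM; congr (_ ^+ _); lia.
have e : p ^+ l.*2.+1 = p * q ^+ l by rewrite exprS -pq -exprM mul2n.
rewrite e in h2 *.
move: (q ^+ s ^+ l) (q ^+ l) (p ^+ s.*2.+1) h3 h4 h2 => Z Y X h3 h4 h2.
by at_field; field; rewrite h1 h2 h3 h4.
Qed.

(** The same cancellation with X = p^(2l+1): the factor 1 - q^(s+1-l), which turns
    [inv_qfact q s.+1 l] into [inv_qfact q s l], differs from 1 - p^(2s+3) = 1 - q^(s+1-l) X by a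
    multiple of 1 - X. *)
Lemma half_kernel_step1 s :
  (1 - p ^+ s.+1.*2.+1) * half_kernel 0 s.+1 = half_kernel 1 s + (q ^+ (s.+1 ^ 2))^-1.
Proof.
have -> : (q ^+ (s.+1 ^ 2))^-1 = q ^+ s.+1 / q ^+ (s.+1 * s.+2).
  rewrite [in RHS]mulnS [in RHS]exprD invfM mulrA mulfV ?expf_neq0 // mul1r.
  by rewrite expnS expn1.
have -> : half_kernel 1 s = \sum_(l < s.+2) f (s + l + 1) / q ^+ ((s + 1) * l) /
     (f l * (1 - p ^+ l.*2.+1)) * jf s l.
  symmetry; exact: (sum_inv_qfactS s
    (fun l => f (s + l + 1) / q ^+ ((s + 1) * l) / (f l * (1 - p ^+ l.*2.+1)))).
rewrite -sum_qfact /half_kernel !mulr_sumr -big_split; apply: eq_bigr => -[l ls] _ /=.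
have h1 := qfact_neq0 l; have h2 := p1 l.*2.
have h3 : q ^+ l != 0 by rewrite expf_neq0.
have h4 : q ^+ s ^+ l != 0 by rewrite !expf_neq0.
rewrite !addn0 !addn1 addSn mulSn exprD exprM -(inv_qfactS s l).
have -> : q ^+ s.+1 = q ^+ (s.+1 - l) * q ^+ l by rewrite -exprD subnK.
have -> : p ^+ s.+1.*2.+1 = q ^+ (s.+1 - l) * p ^+ l.*2.+1.
  by rewrite -pq -exprM -exprD; congr (_ ^+ _); lia.
rewrite [q ^+ (l + _)]exprD (exprM q s.+1).
have -> : q ^+ s.+1 ^+ l = q ^+ l * q ^+ s ^+ l by rewrite exprS exprMn.
move: (q ^+ s ^+ l) (q ^+ l) (q ^+ (s.+1 - l)) (p ^+ l.*2.+1) h3 h4 h2.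
move=> Z Y X P h3 h4 h2.
by at_field; field; rewrite h1 h2 h3 h4.
Qed.

(** Each recurrence appends one term to the same list of inverse triangular powers: i = 2s+1 in
    passing from [half_kernel 0 s] to [half_kernel 1 s], then i = 2s+2 in passing to
    [half_kernel 0 s.+1]. *)
Lemma half_kernelE s :
  (1 - p ^+ s.*2.+1) * half_kernel 0 s = \sum_(i < s.*2.+1) p ^+ s / p ^+ 'C(i.+1, 2) /\
  half_kernel 1 s = \sum_(i < s.*2.+2) p ^+ s.+1 / p ^+ 'C(i.+1, 2).
Proof.
have bin2d n : 'C(n.+1.*2, 2) = (n.+1 * n.*2.+1)%N by rewrite bin2 -doubleMl doubleK.
have pV n m k : (n + k.*2 = m)%N -> (q ^+ k)^-1 = p ^+ n / p ^+ m.
  move=> <-; rewrite exprD -mul2n exprM pq invfM mulrA mulfV ?mul1r //.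
  exact: expf_neq0.
have step n : (1 - p ^+ n.*2.+1) * half_kernel 0 n =
      \sum_(i < n.*2.+1) p ^+ n / p ^+ 'C(i.+1, 2) ->
    half_kernel 1 n = \sum_(i < n.*2.+2) p ^+ n.+1 / p ^+ 'C(i.+1, 2).
  move=> E; rewrite half_kernel_step0 E [RHS]big_ord_recr /= mulr_sumr; congr (_ + _).
    by apply: eq_bigr => i _; rewrite exprS mulrA.
  by apply: pV; rewrite -doubleS bin2d; nia.
suff E : (1 - p ^+ s.*2.+1) * half_kernel 0 s = \sum_(i < s.*2.+1) p ^+ s / p ^+ 'C(i.+1, 2).
  by split; [exact: E | exact: step].
elim: s => [|s IH].
  rewrite /half_kernel !big_ord1 /= inv_qfactE // !qprod0 !expr0.
  have h := p1 0; rewrite expr1 in h *.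
  by at_field; field; rewrite h oner_neq0.
rewrite half_kernel_step1 (step _ IH) [RHS]big_ord_recr /=; congr (_ + _).
by apply: pV; rewrite binS bin1 bin2d; nia.
Qed.

Definition bailey_beta_coef (l : nat) : F :=
  (-1) ^+ l * q ^+ 'C(l.+1, 2) / (f l * (1 - p ^+ l.*2.+1)).

Definition bailey_alpha (e s : nat) : F :=
  \sum_(l < s.+1) bailey_beta_coef l * bailey_coef e s l.

Lemma bailey_alpha_kernel e s : bailey_alpha e s =
  (-1) ^+ s * (1 - q ^+ (s.*2 + e.+1)) * q ^+ ('C(s, 2) + s ^ 2 + e.+1 * s) *
  half_kernel e s.
Proof.
rewrite /bailey_alpha /half_kernel mulr_sumr; apply: eq_bigr => -[l ls] _ /=.
rewrite /bailey_beta_coef /bailey_coef.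
have E : q ^+ ('C(s, 2) + s ^ 2 + e.+1 * s) = q ^+ ((s + e) * l) *
    (q ^+ 'C(l.+1, 2) * q ^+ ((l.*2 + e.+1) * (s - l) + (s - l) ^ 2 + 'C(s - l, 2))).
  rewrite -!exprD; congr (_ ^+ _); move: ls; rewrite ltnS => /subnK.
  move: (s - l)%N => i <-.
  by rewrite binS bin1 binD2; nia.
have -> : (-1) ^+ s = (-1) ^+ l * (-1) ^+ (s - l) :> F by rewrite -exprD subnKC.
have h3 : q ^+ ((s + e) * l) != 0 by rewrite expf_neq0.
rewrite E.
move: (q ^+ ((s + e) * l)) (q ^+ 'C(_, 2)) (q ^+ (_ + 'C(_, 2))) h3 (qfact_neq0 l) (p1 l.*2).
move=> x y z h3 h1 h2.
by at_field; field; rewrite h1 h2 h3.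
Qed.

(** In 1 - q^(2s+1) = (1 + p^(2s+1)) (1 - p^(2s+1)) the second factor is absorbed by [half_kernelE];
    the two terms of the first give the two exponents. *)
Lemma bailey_alpha0E s : bailey_alpha 0 s =
  (-1) ^+ s * \sum_(i < s.*2.+1)
     (p ^+ (3 * s ^ 2 + 2 * s - 'C(i.+1, 2)) + p ^+ (3 * s ^ 2 + 4 * s + 1 - 'C(i.+1, 2))).
Proof.
have [h _] := half_kernelE s; have p2 := p1 s.*2.
rewrite bailey_alpha_kernel -!mulrA; congr (_ * _).
have -> : 1 - q ^+ (s.*2 + 1) = (1 + p ^+ s.*2.+1) * (1 - p ^+ s.*2.+1).
  by rewrite addn1 -pq -exprM mulnC exprM; at_field; ring.
rewrite -mulrA [X in _ * X]mulrCA h !mulr_sumr; apply: eq_bigr => -[i iM] _ /=.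
have pT : p ^+ 'C(i.+1, 2) != 0 by rewrite expf_neq0.
have -> : q ^+ ('C(s, 2) + s ^ 2 + 1 * s) * (p ^+ s / p ^+ 'C(i.+1, 2)) =
    p ^+ (3 * s ^ 2 + 2 * s) / p ^+ 'C(i.+1, 2).
  rewrite mulrA -pq -exprM -exprD; congr (p ^+ _ / _).
  by have := bin2D s; nia.
(* The natural subtraction never truncates: the largest triangular number is s (2s+1). *)
have iT : ('C(i.+1, 2) <= 3 * s ^ 2 + 2 * s)%N.
  by apply: leq_trans (leq_bin2l 2 iM) _; have := bin2D s.*2.+1; nia.
have pB n : ('C(i.+1, 2) <= n)%N -> p ^+ (n - 'C(i.+1, 2)) = p ^+ n / p ^+ 'C(i.+1, 2).
  by move=> /subnK {2}<-; rewrite exprD mulfK.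
rewrite !pB //; last by apply: leq_trans iT _; lia.
rewrite mulrDl mul1r mulrA -exprD; congr (_ + p ^+ _ / _); lia.
Qed.

(** The factor 1 - q^(2s+2) stays unsplit: it equals q^(s+1) [gamma1_weight s] and cancels against
    the denominator of gamma. *)
Lemma bailey_alpha1E s : bailey_alpha 1 s =
  (-1) ^+ s * (1 - q ^+ s.+1.*2) *
  \sum_(i < s.*2.+2) p ^+ (3 * s ^ 2 + 4 * s + 1 - 'C(i.+1, 2)).
Proof.
have [_ h] := half_kernelE s.
rewrite bailey_alpha_kernel h -!mulrA; congr (_ * _).
rewrite addn2 -doubleS; congr (_ * _).
rewrite mulr_sumr; apply: eq_bigr => -[i iM] _ /=.
have pT : p ^+ 'C(i.+1, 2) != 0 by rewrite expf_neq0.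
have iT : ('C(i.+1, 2) <= 3 * s ^ 2 + 4 * s + 1)%N.
  by apply: leq_trans (leq_bin2l 2 iM) _; have := bin2D s.+1.*2; nia.
rewrite mulrA -pq -exprM -exprD; apply: (mulIf pT).
rewrite mulfVK // -exprD subnK //; congr (p ^+ _).
by have := bin2D s; nia.
Qed.

End ClosedForm.

(** * The truncated sequence gamma *)

Definition even_qfact (n : nat) : F := qprod (q ^+ 2) (q ^+ 2) n.

Lemma even_qfactS n : even_qfact n.+1 = even_qfact n * (1 - q ^+ n.+1 ^+ 2).
Proof. by rewrite /even_qfact qprodS -exprM -exprD -exprM; congr (_ * (1 - q ^+ _)); rewrite -mulnS mulnC. Qed.

Definition gamma_sum (e N s : nat) : F :=
  \sum_(m < N) (- q ^+ e) ^+ m * even_qfact m * (jf m s / f (m + s + e.+1)).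

(** Boundary term of the telescoping. For |q| < 1 and fixed r its modulus tends to a nonzero limit
    while its sign alternates with N; this is why L_11 and L_12 are summed by averages. *)
Definition gamma0_edge (N r : nat) : F :=
  - (-1) ^+ N * even_qfact N * jf N r / f (N + r).

(** Here the factor (-q)^N makes the boundary term decay, so ordinary partial sums suffice. *)
Definition gamma1_edge (N r : nat) : F :=
  - (q ^- r - q ^+ r.+1) * (- q) ^+ N / q * even_qfact N * jf N r / f (N + r).+1.

(** The multiplier after which the entries of gamma at s and s + 1 cancel up to a boundary term. *)
Definition gamma1_weight (s : nat) : F := q ^- s.+1 - q ^+ s.+1.

(* The partial sums of gamma telescope in N after combining s and s + 1; this replaces
   the q-Gauss sum in Bailey's lemma and gives an explicit error term. *)
Lemma gamma0_base N : 2 * gamma_sum 0 N 0 = 1 + gamma0_edge N 0.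
Proof.
elim: N => [|N IH].
  rewrite /gamma_sum big_ord0 /gamma0_edge /even_qfact inv_qfactE // !qprod0 expr0.
  by at_field; field; rewrite oner_neq0.
rewrite /gamma_sum big_ord_recr /= mulrDr [2 * _]IH /gamma0_edge -(inv_qfactS N 0).
rewrite !addn0 addn1 subn0 qfactS even_qfactS expr0 !exprS.
have h1 := qfact_neq0 N; have h2 := q1 N; rewrite exprS in h2.
by at_field; field; rewrite h1 h2.
Qed.

(** With [gamma0_base] this determines gamma as (-1)^s / 2 up to boundary terms. *)
Lemma gamma0_step N s : gamma_sum 0 N s.+1 + gamma_sum 0 N s = gamma0_edge N s.+1.
Proof.
elim: N => [|N IH].
  by rewrite /gamma_sum !big_ord0 /gamma0_edge inv_qfact_small // mulr0 mul0r addr0.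
rewrite /gamma_sum !big_ord_recr /= addrACA IH /gamma0_edge.
rewrite expr0 -(inv_qfactS N s.+1) !inv_qfactSS subSS !addnS addSn addn0.
case: (leqP s N) => [sN|Ns]; last by rewrite inv_qfact_small // !(mulr0, mul0r, addr0).
have eN : q ^+ N.+1 ^+ 2 = q ^+ (N - s) * q ^+ (N + s).+2.
  by rewrite -exprM -exprD; congr (_ ^+ _); lia.
rewrite even_qfactS eN !qfactS [(-1) ^+ N.+1]exprS.
have h1 := qfact_neq0 (N + s); have h2 := q1 (N + s); have h3 := q1 (N + s).+1.
move: (q ^+ (N + s).+2) (q ^+ (N + s).+1) (q ^+ (N - s)) h2 h3 => x y z h2 h3.
by at_field; field; rewrite h1 h2 h3.
Qed.

Lemma gamma1_base N : gamma_sum 1 N 0 * gamma1_weight 0 = q^-1 + gamma1_edge N 0.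
Proof.
have h0 := q1 0; rewrite expr1 in h0.
elim: N => [|N IH].
  rewrite /gamma_sum big_ord0 /gamma1_edge /even_qfact inv_qfactE // !qprodS !qprod0 !expr0 expr1.
  by at_field; field; rewrite q0 oner_neq0 h0.
rewrite /gamma_sum big_ord_recr /= mulrDl [_ * gamma1_weight 0]IH /gamma1_edge.
rewrite -(inv_qfactS N 0) /gamma1_weight !addn0 addn2 subn0 !qfactS even_qfactS !exprS !expr0 !mulr1.
have h1 := qfact_neq0 N; have h2 := q1 N; have h3 := q1 N.+1; rewrite !exprS in h2 h3.
by at_field; field; rewrite h1 h2 h3 q0 oner_neq0.
Qed.

Lemma gamma1_step N s :
  gamma_sum 1 N s.+1 * gamma1_weight s.+1 + gamma_sum 1 N s * gamma1_weight s =
  gamma1_edge N s.+1.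
Proof.
elim: N => [|N IH].
  by rewrite /gamma_sum !big_ord0 /gamma1_edge inv_qfact_small // !(mulr0, mul0r) addr0.
rewrite /gamma_sum !big_ord_recr /= !mulrDl addrACA IH /gamma1_edge.
rewrite expr1 -(inv_qfactS N s.+1) !inv_qfactSS subSS !addnS !addSn addn0.
case: (leqP s N) => [sN|Ns]; last by rewrite inv_qfact_small // !(mulr0, mul0r, addr0).
have eN : q ^+ N.+1 = q ^+ (N - s) * q ^+ s.+1 by rewrite -exprD; congr (_ ^+ _); lia.
have e3 : q ^+ (N + s).+3 = q ^+ (N - s) * q ^+ s.+1 * q ^+ s.+1 * q.
  by rewrite -!exprD -exprSr; congr (_ ^+ _); lia.
have e2 : q ^+ (N + s).+2 = q ^+ (N - s) * q ^+ s.+1 * q ^+ s.+1.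
  by rewrite -!exprD; congr (_ ^+ _); lia.
have h1 := qfact_neq0 (N + s).+1; have h2 := q1 (N + s).+1; have h3 := q1 (N + s).+2.
have h4 : q ^+ s.+1 != 0 by rewrite expf_neq0.
rewrite /gamma1_weight even_qfactS eN !(qfactS (N + s).+1, qfactS (N + s).+2) !(exprS q s.+1, exprS q s.+2).
rewrite [(- q) ^+ N.+1]exprS e2 e3 in h2 h3 *.
move: (q ^+ (N - s)) (q ^+ s.+1) h4 h2 h3 => z y h4 h2 h3.
by at_field; field; rewrite h1 h2 h3 h4 q0.
Qed.

End QSeries.

(** * Ideals of Z[sqrt 6] *)

Definition OM_nrm (x : OM) : int := x.1 ^+ 2 - 6 * x.2 ^+ 2.
Definition OM_conj (x : OM) : OM := (x.1, - x.2).
Definition OM_principal (a : OM) : set OM := [set x | exists r, x = OM_mul r a]%classic.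

Lemma OM_nrmM x y : OM_nrm (OM_mul x y) = OM_nrm x * OM_nrm y.
Proof. rewrite /OM_nrm /OM_mul /=; ring. Qed.

Lemma OM_mulA x y z : OM_mul x (OM_mul y z) = OM_mul (OM_mul x y) z.
Proof. by rewrite /OM_mul /=; congr pair; ring. Qed.

Lemma OM_mulC x y : OM_mul x y = OM_mul y x.
Proof. by rewrite /OM_mul /=; congr pair; ring. Qed.

Lemma OM_mul1 x : OM_mul (1, 0) x = x.
Proof. by case: x => a b; rewrite /OM_mul /=; congr pair; ring. Qed.

Lemma OM_conjM x : OM_mul (OM_conj x) x = (OM_nrm x, 0).
Proof. by rewrite /OM_mul /OM_nrm /=; congr pair; ring. Qed.

Lemma OM_subE (x y : OM) : x - y = (x.1 - y.1, x.2 - y.2).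
Proof. by case: x => a b; case: y. Qed.

(** For nonzero a and b the exponent of 2 would be even in a^2 and odd in 6 b^2. *)
Lemma square_eq6 (a b : int) : a ^+ 2 = 6 * b ^+ 2 -> a = 0 /\ b = 0.
Proof.
move=> E; have E' : (`|a| * `|a| = 6 * (`|b| * `|b|))%N by nia.
suff b0 : b = 0 by move: E; rewrite b0; nia.
case: (posnP `|b|%N) => [|b_gt0]; first by lia.
have a_gt0 : (0 < `|a|)%N by nia.
have := congr1 (logn 2) E'.
rewrite !lognM ?muln_gt0 ?a_gt0 ?b_gt0 //; have -> : logn 2 6 = 1%N by [].
lia.
Qed.

Lemma OM_nrm_eq0 x : OM_nrm x = 0 -> x = 0.
Proof. by case: x => a b; rewrite /OM_nrm /= => /subr0_eq /square_eq6[-> ->]. Qed.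

(** * Euclidean division and principal ideals *)

(** Excludes the borderline case of [rat_euclid], by parity of the exponent of 5. *)
Lemma square_neq5_24 (s : rat) : 24 * s ^+ 2 != 5.
Proof.
apply/eqP => E.
have d0 : (denq s)%:~R != 0 :> rat by rewrite intr_eq0 denq_neq0.
have E2 : 24 * (numq s) ^+ 2 = 5 * (denq s) ^+ 2.
  apply: (@intr_inj rat); rewrite !rmorphM /=.
  have -> : 5%:~R = 24 * (((numq s)%:~R / (denq s)%:~R) ^+ 2) :> rat by rewrite divq_num_den E.
  by field.
have d := denq_gt0 s.
have E3 : (24 * (`|numq s| * `|numq s|) = 5 * (`|denq s| * `|denq s|))%N by nia.
have n0 : (0 < `|numq s|)%N by nia.
have := congr1 (logn 5) E3.
have dn : (0 < `|denq s|)%N by lia.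
rewrite !lognM ?muln_gt0 ?n0 ?dn //.
have -> : logn 5 24 = 0%N by []. have -> : logn 5 5 = 1%N by [].
lia.
Qed.

Lemma rat_round (r : rat) : exists a : int, `|r - a%:~R| <= 2^-1.
Proof.
exists (Num.floor (r + 2^-1)).
have := real_floor_itv (num_real (r + 2^-1)); rewrite intrD => /andP[h1 h2].
rewrite ler_norml; lra.
Qed.

Lemma rat_dist (r : rat) : exists2 d, 0 <= d <= 2^-1 &
  forall v, v \in [:: d; 1 - d; 1 + d] -> exists a : int, (r - a%:~R) ^+ 2 = v ^+ 2.
Proof.
have [a ha] := rat_round r.
have [h|h] := leP 0 (r - a%:~R).
  exists (r - a%:~R) => [|v]; first by rewrite h /= -(ger0_norm h).
  rewrite !inE => /or3P[] /eqP->; [exists a | exists (a + 1) | exists (a - 1)];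
    rewrite ?rmorphB ?rmorphD /=; ring.
exists (a%:~R - r) => [|v]; first by move: ha; rewrite ltr0_norm // opprB => ->; lra.
rewrite !inE => /or3P[] /eqP->; [exists a | exists (a - 1) | exists (a + 1)];
    rewrite ?rmorphB ?rmorphD /=; ring.
Qed.

(** Rounding both coordinates is not enough, since 6 t^2 can reach 3/2. With d in [0, 1/2] the
    distance from r to the integers, use d^2 if 6 t^2 < 1, (1 - d)^2 if 1 <= 6 t^2 < 5/4, and (1 +
    d)^2 if 6 t^2 > 5/4. At 6 t^2 = 5/4 and d = 1/2 the last two would give exactly -1 and 1. *)
Lemma rat_euclid (r s : rat) : exists a b : int,
  `|(r - a%:~R) ^+ 2 - 6 * (s - b%:~R) ^+ 2| < 1.
Proof.
have [b hb] := rat_round s.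
have [d /andP[d0 d1] D] := rat_dist r.
set t := s - b%:~R in hb *.
have t2 : t ^+ 2 <= 4^-1.
  move: hb; rewrite ler_norml => /andP[h1 h2]; nra.
have t0 : 0 <= t ^+ 2 by exact: sqr_ge0.
have use v : v \in [:: d; 1 - d; 1 + d] -> `|v ^+ 2 - 6 * t ^+ 2| < 1 ->
    exists a b : int, `|(r - a%:~R) ^+ 2 - 6 * (s - b%:~R) ^+ 2| < 1.
  by move=> /D[a <-] h; exists a, b.
have [h|h] := ltP (6 * t ^+ 2) 1.
  apply: (use d); first by rewrite !inE eqxx.
  rewrite ltr_norml; nra.
have [h2|h2|h2] := ltgtP (24 * t ^+ 2) 5.
- apply: (use (1 - d)); first by rewrite !inE eqxx orbT.
  rewrite ltr_norml; nra.
- apply: (use (1 + d)); first by rewrite !inE eqxx !orbT.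
  rewrite ltr_norml; nra.
- by move/eqP: h2; rewrite (negPf (square_neq5_24 t)).
Qed.

Lemma OM_euclid (x y : OM) : y != 0 ->
  exists k, `|OM_nrm (x - OM_mul k y)| < `|OM_nrm y|.
Proof.
move=> y0; have n0 : OM_nrm y != 0 by apply: contra_neq y0 => /OM_nrm_eq0.
set n := OM_nrm y in n0 *.
have nQ : n%:~R != 0 :> rat by rewrite intr_eq0.
(* The quotient x / y is X / n, so its rational coordinates are those of X divided by n. *)
pose X := OM_mul x (OM_conj y).
have [a [b h]] := rat_euclid (X.1%:~R / n%:~R) (X.2%:~R / n%:~R).
exists (a, b).
have E : OM_nrm (x - OM_mul (a, b) y) * n = (X.1 - a * n) ^+ 2 - 6 * (X.2 - b * n) ^+ 2.
  rewrite OM_subE /X /n /OM_nrm /OM_mul /OM_conj /=; ring.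
clearbody n X.
have EQ : (OM_nrm (x - OM_mul (a, b) y))%:~R =
  n%:~R * ((X.1%:~R / n%:~R - a%:~R) ^+ 2 - 6 * (X.2%:~R / n%:~R - b%:~R) ^+ 2) :> rat.
  apply: (mulIf nQ); rewrite -intrM E !(rmorphB, rmorphM, rmorphXn) /=.
  by field.
rewrite -(ltr_int rat) !intr_norm EQ normrM gtr_pMr //.
by rewrite normr_gt0.
Qed.

Lemma ideal_principal (I : set OM) : nonzero_ideal I ->
  exists2 a, a != 0 & I = OM_principal a.
Proof.
move=> [[I0 [IB IM]] [x0 [x00 Ix0]]].
have ex : exists n, `[< exists a, [/\ I a, a != 0 & `|OM_nrm a|%N = n] >].
  by exists `|OM_nrm x0|%N; apply/asboolP; exists x0.
case: (ex_minnP ex) => n /asboolP[a [Ia a0 an]] min.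
exists a => //; apply/seteqP; split => [x Ix|_ [r ->]]; last exact: IM.
have [k hk] := OM_euclid x a0; exists k; apply/eqP; rewrite -subr_eq0.
apply/negPn/negP => r0.
have : (n <= `|OM_nrm (x - OM_mul k a)%R|)%N.
  apply: min; apply/asboolP; exists (x - OM_mul k a); split => //.
  by apply: IB => //; apply: IM.
by rewrite -an; lia.
Qed.

(** * Absolute norms and counting of ideals *)

Lemma ideal_norm_unique (I : set OM) m n :
  ideal_norm_is I m -> ideal_norm_is I n -> m = n.
Proof.
wlog suff W : I m n / ideal_norm_is I m -> ideal_norm_is I n -> (m <= n)%N.
  by move=> h1 h2; apply/eqP; rewrite eqn_leq !(W I).
move=> [f [fs fI]] [g [gs gI]].
pose h j := g (projT1 (cid (fs j))).
have hi : injective h.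
  move=> i j /gI /fI; rewrite /h.
  by case: (cid (fs i)) => x /= <-; case: (cid (fs j)) => y /= <-.
by have := leq_card h hi; rewrite !card_ord.
Qed.

Lemma ideal_norm_card (T : finType) (I : set OM) (f : OM -> T) :
  (forall t, exists x, f x = t) -> (forall x y, f x = f y <-> I (x - y)) ->
  ideal_norm_is I #|T|.
Proof.
move=> fs fI; exists (fun x => enum_rank (f x)); split => [j|x y].
  by have [x fx] := fs (enum_val j); exists x; rewrite fx enum_valK.
by rewrite -fI; split => [/enum_rank_inj//|->].
Qed.

Lemma modz_ord_subproof (n : nat) (a : int) : (0 < n)%N -> (`|(a %% n)%Z| < n)%N.
Proof. by move=> n0; have := ltz_pmod a (n0 : 0 < n%:Z); have := modz_ge0 a (lt0r_neq0 (n0 : 0 < n%:Z)); lia. Qed.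

Definition modz_ord (n : nat) (n0 : (0 < n)%N) (a : int) : 'I_n :=
  Ordinal (modz_ord_subproof a n0).

Lemma modz_ord_eq n (n0 : (0 < n)%N) a b :
  modz_ord n0 a = modz_ord n0 b <-> (n %| a - b)%Z.
Proof.
rewrite -eqz_mod_dvd; split => [/(congr1 val) /= E|/eqP E]; last first.
  by apply: val_inj; rewrite /= E.
apply/eqP; have := modz_ge0 a (lt0r_neq0 (n0 : 0 < n%:Z)).
have := modz_ge0 b (lt0r_neq0 (n0 : 0 < n%:Z)).
by move: E; lia.
Qed.

Lemma modz_ordK n (n0 : (0 < n)%N) (i : 'I_n) : modz_ord n0 i = i.
Proof. by apply: val_inj; rewrite /= modz_small //; have := ltn_ord i; lia. Qed.

Lemma divz_sub (g p r c : int) : g != 0 -> p - r = c * g -> (p %/ g)%Z - (r %/ g)%Z = c.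
Proof.
move=> g0 /eqP; rewrite subr_eq => /eqP ->.
by rewrite divzMDl // addrK.
Qed.

(* With g = gcd(x, y) and u x + v y = g, the ideal (x + y sqrt 6) is g times the
   lattice spanned by (c, 1) and (N, 0), where N is the norm of the primitive part. *)
Lemma ideal_norm_principal a : a != 0 -> ideal_norm_is (OM_principal a) `|OM_nrm a|%N.
Proof.
move=> a0; have n0 : OM_nrm a != 0 by apply: contra_neq a0 => /OM_nrm_eq0.
case: a a0 n0 => x y _; rewrite /OM_nrm /= => n0.
have [u [v uv]] := Bezoutz x y.
have [G Gg] : exists G : nat, gcdz x y = G by exists (gcdn `|x| `|y|).
have /dvdzP[x' ex] := dvdz_gcdl x y; have /dvdzP[y' ey] := dvdz_gcdr x y.
rewrite Gg in ex ey uv.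
have g0 : G%:Z != 0 by apply: contra_neq n0 => g0; rewrite ex ey g0; ring.
have G0 : (0 < G)%N by lia.
have uv' : u * x' + v * y' = 1.
  by apply: (mulIf g0); rewrite mul1r -[RHS]uv ex ey; ring.
pose N' := x' ^+ 2 - 6 * y' ^+ 2; pose c := v * x' + 6 * (u * y').
have nN : x ^+ 2 - 6 * y ^+ 2 = G%:Z * G%:Z * N' by rewrite ex ey /N'; ring.
have N0 : (0 < `|N'|)%N by rewrite absz_gt0; apply: contra_neq n0 => e; rewrite nN e mulr0.
pose f (p : OM) := (modz_ord G0 p.1, modz_ord G0 p.2,
  modz_ord N0 ((p.1 %/ G)%Z - (p.2 %/ G)%Z * c)).
have -> : `|(x ^+ 2 - 6 * y ^+ 2)%R|%N = #|{: 'I_G * 'I_G * 'I_`|N'|}|.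
  by rewrite !card_prod !card_ord nN !abszM !absz_nat.
apply: (@ideal_norm_card _ _ f) => [[[i j] k]|p r].
  exists (k%:Z * G%:Z + i%:Z, j%:Z); rewrite /f /= modz_ordK.
  have -> : modz_ord G0 (k%:Z * G%:Z + i%:Z) = i.
    rewrite -[RHS](modz_ordK G0); apply/modz_ord_eq.
    by rewrite addrK dvdz_mull.
  have iG := ltn_ord i; have jG := ltn_ord j.
  rewrite divzMDl // !divz_small; try lia.
  by rewrite mul0r subr0 addr0 modz_ordK.
have fE : (f p = f r) <-> [/\ (G %| p.1 - r.1)%Z, (G %| p.2 - r.2)%Z &
    (`|N'|%N %| ((p.1 %/ G)%Z - (p.2 %/ G)%Z * c) - ((r.1 %/ G)%Z - (r.2 %/ G)%Z * c))%Z].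
  split => [E|[/(modz_ord_eq G0) e1 /(modz_ord_eq G0) e2 /(modz_ord_eq N0) e3]].
    by split; apply/modz_ord_eq; case: E => e1 e2 e3; apply: val_inj.
  by rewrite /f e1 e2 e3.
have dN z : (`|N'|%N %| z)%Z = (N' %| z)%Z by rewrite !dvdzE absz_nat.
apply: (iff_trans fE); rewrite dN OM_subE; split.
  move=> [/dvdzP[A eA] /dvdzP[B eB]].
  have -> : (p.1 %/ G)%Z - (p.2 %/ G)%Z * c - ((r.1 %/ G)%Z - (r.2 %/ G)%Z * c) = A - B * c.
    by rewrite -(divz_sub g0 eA) -(divz_sub g0 eB); ring.
  move=> /dvdzP[k ek].
  have eA' : A = B * c + k * N' by rewrite -ek; ring.
  exists (B * v + k * x', B * u - k * y'); rewrite eA eB eA' /OM_mul /= ex ey.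
  congr pair; first by rewrite /c /N'; ring.
  by rewrite -[in LHS](mulr1 B) -uv'; ring.
move=> [[r1 r2]]; rewrite /OM_mul /= ex ey => -[e1 e2].
have eA : p.1 - r.1 = (r1 * x' + 6 * (r2 * y')) * G by rewrite e1; ring.
have eB : p.2 - r.2 = (r1 * y' + r2 * x') * G by rewrite e2; ring.
rewrite eA eB !dvdz_mull //; split => //.
apply/dvdzP; exists (r1 * u - r2 * v).
transitivity ((r1 * x' + 6 * (r2 * y')) - (r1 * y' + r2 * x') * c).
  by rewrite -(divz_sub g0 eA) -(divz_sub g0 eB); ring.
rewrite /c /N'.
have -> : r1 * x' + 6 * (r2 * y') = (r1 * x' + 6 * (r2 * y')) * (u * x' + v * y') by rewrite uv' mulr1.
ring.
Qed.

Lemma OM_principal_mul a b : OM_principal a = OM_principal b -> exists r, b = OM_mul r a.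
Proof.
move=> E; have : OM_principal b b by exists (1, 0); rewrite OM_mul1.
by rewrite -E.
Qed.

Lemma OM_principal_unit a r : OM_nrm r = 1 -> OM_principal (OM_mul r a) = OM_principal a.
Proof.
move=> r1; apply/seteqP; split => _ [k ->].
  by exists (OM_mul k r); rewrite OM_mulA.
exists (OM_mul k (OM_conj r)); rewrite OM_mulA -[OM_mul (OM_mul k _) r]OM_mulA.
by rewrite OM_conjM r1 (OM_mulC k (1, 0)) OM_mul1.
Qed.

(** Two members of D generating the same ideal differ by a factor of norm 1, as both have norm -n.
    Hence D lists the ideals once each as soon as it meets every orbit of the units of norm 1
    exactly once. *)
Lemma num_ideals_representatives n (D : seq OM) : (0 < n)%N -> uniq D ->
  (forall a, a \in D -> OM_nrm a = - n%:Z) ->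
  (forall a, `|OM_nrm a|%N = n -> exists r, OM_nrm r = 1 /\ OM_mul r a \in D) ->
  (forall a r, a \in D -> OM_mul r a \in D -> OM_nrm r = 1 -> OM_mul r a = a) ->
  num_ideals n = size D.
Proof.
move=> n0 uD nD red irr.
rewrite /num_ideals.
(* Writing the set as a finite image also settles its finiteness; on an infinite set [fset_set]
   would return the empty set. *)
have -> : [set I : set OM | nonzero_ideal I /\ ideal_norm_is I n]%classic =
    [set` [fset OM_principal a | a in D]%fset]%classic.
  apply/seteqP; split => I /=.
    move=> [/ideal_principal[a a0 ->] an].
    have an' := ideal_norm_unique (ideal_norm_principal a0) an.
    have [r [r1 rD]] := red a an'.
    by apply/imfsetP; exists (OM_mul r a) => //=; rewrite OM_principal_unit.
  move=> /imfsetP[a /= aD ->].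
  have a0 : a != 0.
    by apply: contraTneq n0 => a0; have := nD _ aD; rewrite a0 /OM_nrm /=; lia.
  split; last by have := ideal_norm_principal a0; rewrite nD // abszN absz_nat.
  split; last by exists a; split => //; exists (1, 0); rewrite OM_mul1.
  split; first by exists 0; rewrite /OM_mul /= !mul0r.
  split => [_ _ [r ->] [s ->]|r _ [s ->]]; last by exists (OM_mul r s); rewrite OM_mulA.
  exists (r - s); rewrite !OM_subE /OM_mul /=; congr pair; ring.
rewrite set_fsetK card_in_imfset /= ?undup_id // => a b aD bD E.
have [r rb] := OM_principal_mul E; rewrite rb (irr a r) -?rb //.
apply: (@mulIf _ (- n%:Z)); first by lia.
by rewrite mul1r -(nD _ aD) -OM_nrmM -rb !nD.
Qed.

(** * Units of norm 1 and fundamental domains *)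

Lemma pell_unit (a b : int) : a ^+ 2 - 6 * b ^+ 2 = 1 ->
  b = 0 /\ (a = 1 \/ a = -1) \/ 2 <= b \/ b <= -2.
Proof.
move=> E; have [b0|b0] := eqVneq b 0; first by left; split => //; move: E; rewrite b0; nia.
right; have [b1|b1] := eqVneq b 1; last have [b2|b2] := eqVneq b (-1); last by lia.
  all: have [|[/andP[]|]] : a <= -3 \/ -2 <= a <= 2 \/ 3 <= a by lia.
  all: move=> *; exfalso; subst b; nia.
Qed.

(* Multiplication by the unit 5 - 2 sqrt 6 (or its inverse) decreases y as long as |x| > 2y. *)
Lemma OM_reduce (n : nat) (a : OM) : odd n -> OM_nrm a = - n%:Z ->
  exists r, OM_nrm r = 1 /\ 0 < (OM_mul r a).2 /\ `|(OM_mul r a).1| < 2 * (OM_mul r a).2.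
Proof.
move=> on na.
suff W : forall k x y, (`|y| <= k)%N -> 0 < y -> x ^+ 2 - 6 * y ^+ 2 = - n%:Z ->
   exists r, OM_nrm r = 1 /\ 0 < (OM_mul r (x, y)).2 /\
     `|(OM_mul r (x, y)).1| < 2 * (OM_mul r (x, y)).2.
  case: a na => x y na; have [y0|y0|y0] := ltgtP 0 y.
  - exact: (W `|y|%N).
  - have [|||r [r1 [r2 r3]]] := W `|y|%N (- x) (- y) => //; try lia.
      by rewrite -na /OM_nrm /=; ring.
    exists (- r.1, - r.2); split; first by rewrite -[RHS]r1 /OM_nrm /=; ring.
    have -> : OM_mul (- r.1, - r.2) (x, y) = OM_mul r (- x, - y).
      by rewrite /OM_mul /=; congr pair; ring.
    by split.
  - by move: na; rewrite -y0 /OM_nrm /=; nia.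
elim=> [|k IH] x y yk y0 nxy; first by lia.
have [h|h|h] := ltgtP `|x| (2 * y).
- exists (1, 0); rewrite OM_mul1; split; last by split.
  by rewrite /OM_nrm /=; ring.
(* Here e is the sign of x, and the new y is 5y - 2|x|: it is below y because |x| > 2y, and positive
   because x^2 < 6y^2. *)
- have step (e : int) : e = 1 \/ e = -1 -> 0 < e * x -> exists r, OM_nrm r = 1 /\
     0 < (OM_mul r (x, y)).2 /\ `|(OM_mul r (x, y)).1| < 2 * (OM_mul r (x, y)).2.
    move=> e1 ex.
    have [|||r [r1 r2]] := IH (5 * x - 12 * (e * y)) (5 * y - 2 * (e * x)); try nia.
    exists (OM_mul r (5, - 2 * e)).
    have -> : OM_mul (OM_mul r (5, - 2 * e)) (x, y) =
      OM_mul r (5 * x - 12 * (e * y), 5 * y - 2 * (e * x)).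
      by rewrite -OM_mulA; congr OM_mul; rewrite /OM_mul /=; congr pair; ring.
    by split => //; rewrite OM_nrmM r1 mul1r /OM_nrm /=; case: e1 => ->.
  have [x0|x0|x0] := ltgtP 0 x; [apply: (step 1); lia | apply: (step (-1)); lia | by move: h; rewrite -x0 normr0; lia].
(* On the boundary n = 2y^2, against n odd. *)
- exfalso; have E : x ^+ 2 = 4 * y ^+ 2 by rewrite -(real_normK (num_real x)) h; ring.
  by have : n%:Z = 2 * y ^+ 2; lia.
Qed.

Lemma mem_flatten_iota (T : eqType) (g : nat -> seq T) K t :
  (t \in flatten [seq g s | s <- iota 0 K]) = [exists s : 'I_K, t \in g s].
Proof.
apply/flatten_mapP/existsP => [[s]|[s tg]]; last by exists (val s) => //; rewrite mem_iota /=.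
by rewrite mem_iota /= => sK tg; exists (Ordinal sK).
Qed.

Lemma uniq_flatten_key (T : eqType) (g : nat -> seq T) (key : T -> nat) K :
  (forall s, uniq (g s)) -> (forall s t, t \in g s -> key t = s) ->
  uniq (flatten [seq g s | s <- iota 0 K]).
Proof.
move=> ug kg; elim: K => // K IH.
rewrite -addn1 iotaD map_cat flatten_cat /= cats0 add0n cat_uniq IH ug andbT /=.
apply/hasPn => t tK; apply/negP; rewrite mem_flatten_iota => /existsP[s ts].
by have := ltn_ord s; rewrite -(kg _ _ ts) (kg _ _ tK) ltnn.
Qed.

(** Common frame for both quadratic forms: representatives are [phi b t] with a sign b, the source
    of the factor 2, and t in a block g s. Since [key] recovers s, the blocks are disjoint. *)
Lemma num_ideals_blocks (n : nat) (g : nat -> seq (nat * nat)) (w key : nat * nat -> nat)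
    (phi : bool -> nat * nat -> OM) : (0 < n)%N ->
  (forall s, uniq (g s)) -> (forall s t, t \in g s -> key t = s) ->
  (forall b b' t t', phi b t = phi b' t' -> (b, t) = (b', t')) ->
  (forall b s t, t \in g s -> w t = n -> OM_nrm (phi b t) = - n%:Z) ->
  (forall a, `|OM_nrm a|%N = n -> exists r, OM_nrm r = 1 /\
     exists b s t, [/\ (s <= n)%N, t \in g s, w t = n & OM_mul r a = phi b t]) ->
  (forall b b' s s' t t' r, t \in g s -> t' \in g s' ->
     OM_nrm r = 1 -> OM_mul r (phi b t) = phi b' t' -> r = (1, 0)) ->
  num_ideals n = (2 * \sum_(s < n.+1) count_mem n [seq w t | t <- g s])%N.
Proof.
move=> n0 ug kg phi_inj nphi red irr.
pose P := [seq t <- flatten [seq g s | s <- iota 0 n.+1] | w t == n].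
have mP t : reflect (exists s, [/\ (s <= n)%N, t \in g s & w t = n]) (t \in P).
  rewrite mem_filter mem_flatten_iota; apply: (iffP andP) => [[/eqP wt /existsP[s ts]]|].
    by exists s; split => //; rewrite -ltnS.
  by move=> [s [sn ts ->]]; split => //; apply/existsP; exists (Ordinal (sn : s < n.+1)%N).
have sP : size P = \sum_(s < n.+1) count_mem n [seq w t | t <- g s].
  rewrite size_filter count_flatten sumnE big_map big_map -[iota _ _]/(index_iota 0 n.+1) big_mkord.
  by apply: eq_bigr => s _; rewrite count_map; apply: eq_count.
have uP : uniq P by rewrite filter_uniq // (uniq_flatten_key n.+1 ug kg).
pose D := [seq phi b t | b <- [:: true; false], t <- P].
rewrite -sP (@num_ideals_representatives n D) //; first by rewrite size_allpairs.
- by apply: allpairs_uniq => // -[b t] [b' t'] _ _ /= /phi_inj.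
- by move=> a /allpairsP[[b t] /= [_ /mP[s [sn ts wt]] ->]]; apply: (nphi _ s).
- move=> a /red[r [r1 [b [s [t [sn ts wt E]]]]]]; exists r; split => //; rewrite E.
  by apply: allpairs_f; [case: (b) | apply/mP; exists s].
- move=> a r /allpairsP[[b t] /= [_ /mP[s [sn ts wt]] ->]].
  move=> /allpairsP[[b' t'] /= [_ /mP[s' [sn' ts' wt']] E]] r1.
  by rewrite (irr b b' s s' t t' r) ?OM_mul1.
Qed.

Lemma int_square_mod8 (x : int) : exists m k,
  x = 2 * m /\ (x ^+ 2 = 8 * k \/ x ^+ 2 = 8 * k + 4) \/ x = 2 * m + 1 /\ x ^+ 2 = 8 * k + 1.
Proof.
have [m [|[|[|]]]] : exists m, x = 4 * m \/ x = 4 * m + 1 \/ x = 4 * m + 2 \/ x = 4 * m + 3.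
- exists (x %/ 4)%Z; lia.
- by move=> ->; exists (2 * m), (2 * m ^+ 2); left; split; [|left]; ring.
- by move=> ->; exists (2 * m), (2 * m ^+ 2 + m); right; split; ring.
- by move=> ->; exists (2 * m + 1), (2 * m ^+ 2 + 2 * m); left; split; [|right]; ring.
- by move=> ->; exists (2 * m + 1), (2 * m ^+ 2 + 3 * m + 1); right; split; ring.
Qed.

(** The ratio a / b exceeds sqrt 6 > 12/5, and is largest at the fundamental unit (5, 2). *)
Lemma pell_bounds (a b : int) : a ^+ 2 - 6 * b ^+ 2 = 1 -> 2 <= b -> 0 < a ->
  12 * b < 5 * a /\ 2 * a <= 5 * b.
Proof. by move=> E b2 a0; split; nia. Qed.

Lemma pell_domain7_pos (a b x y : int) : a ^+ 2 - 6 * b ^+ 2 = 1 -> 2 <= b ->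
  `|x| < 2 * y -> ~ `|a * x + 6 * (b * y)| < 2 * (a * y + b * x).
Proof.
move=> E b2; rewrite !ltr_norml => /andP[h1 h2] /andP[h3 h4].
have y0 : 0 < y by lia.
have [a0|a0] := ltP 0 a.
  have [k1 k2] := pell_bounds E b2 a0.
  (* With (x', y') the image, x' - 2y' = (a - 2b)(x + 2y) + (10b - 4a) y, so x' > 2y'. *)
  have : 0 < (a - 2 * b) * (x + 2 * y) by apply: mulr_gt0; lia.
  have : 0 <= (10 * b - 4 * a) * y by apply: mulr_ge0; lia.
  lia.
have E' : (- a) ^+ 2 - 6 * b ^+ 2 = 1 by rewrite sqrrN.
have a1 : 0 < - a by have := sqrf_eq0 a; nia.
have [k1 k2] := pell_bounds E' b2 a1.
(* For negative a the image has y' < 0: -y' = (-a - 2b) y + b (2y - x). *)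
have : 0 <= (- a - 2 * b) * y by apply: mulr_ge0; lia.
have : 0 < b * (2 * y - x) by apply: mulr_gt0; lia.
lia.
Qed.

Lemma pell_domain7 (a b x y : int) : a ^+ 2 - 6 * b ^+ 2 = 1 ->
  `|x| < 2 * y -> `|a * x + 6 * (b * y)| < 2 * (a * y + b * x) -> a = 1 /\ b = 0.
Proof.
move=> E h1 h2; have [[b0 [a1|a1]] //|[hb|hb]] := pell_unit E.
- by exfalso; move: h2; rewrite b0 a1; lia.
- by case: (pell_domain7_pos E hb h1 h2).
(* Conjugation, x to -x and b to -b, preserves the domain and reduces to b >= 2. *)
- have E' : a ^+ 2 - 6 * (- b) ^+ 2 = 1 by rewrite sqrrN.
  case: (@pell_domain7_pos a (- b) (- x) y E'); rewrite ?normrN //; first lia.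
  have -> : a * - x + 6 * (- b * y) = - (a * x + 6 * (b * y)) by ring.
  by rewrite normrN mulrNN.
Qed.

(* The norms 6y^2 - x^2 with y = 2(s+1) and odd |x| < 2y. *)
Definition norm_block7 (s : nat) : seq nat :=
  [seq (24 * s.+1 ^ 2 - i.*2.+1 ^ 2)%N | i <- iota 0 s.*2.+2].

(** Modulo 8 the norm n is impossible, and the norm -n forces x odd and y even. The representatives
    in |x| < 2y are thus y = 2(s+1), x = 2i+1 or -(2i+1), with i < 2s+2. *)
Lemma num_ideals7 n : (n %% 8 = 7)%N ->
  num_ideals n = (2 * \sum_(s < n.+1) count_mem n (norm_block7 s))%N.
Proof.
move=> n7.
have n0 : (0 < n)%N by case: n n7.
have on : odd n by lia.
pose g s := [seq (s.+1, i) | i <- iota 0 s.*2.+2].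
pose w (t : nat * nat) := (24 * t.1 ^ 2 - t.2.*2.+1 ^ 2)%N.
pose phi (b : bool) (t : nat * nat) : OM :=
  ((if b then 1 else -1) * (2 * t.2%:Z + 1), 2 * t.1%:Z).
have mg s t : t \in g s -> t.1 = s.+1 /\ (t.2 < s.*2.+2)%N.
  by case/mapP => i; rewrite mem_iota => /andP[_ h] ->.
rewrite (@num_ideals_blocks n g w (fun t => t.1.-1) phi) //.
- by congr muln; apply: eq_bigr => s _; rewrite -map_comp.
- by move=> s; rewrite map_inj_uniq ?iota_uniq // => i j [].
- by move=> s t /mg[->].
- by move=> b b' [z i] [z' i']; rewrite /phi /= => -[]; case: b b' => [][] /= *; congr (_, (_, _)); lia.
- move=> b s [z i] /mg /= [-> ih]; rewrite /w /OM_nrm /= => <-.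
  by case: b => /=; nia.
- move=> a an.
  have na : OM_nrm a = - n%:Z.
    have : OM_nrm a = n%:Z \/ OM_nrm a = - n%:Z by lia.
    case=> // e; exfalso; move: e; rewrite /OM_nrm; case: a {an} => x y /= e.
    have [mx [kx hx]] := int_square_mod8 x; have [my [ky hy]] := int_square_mod8 y.
    lia.
  have [r [r1 [r2 r3]]] := OM_reduce on na.
  exists r; split => //; move: r2 r3.
  have : OM_nrm (OM_mul r a) = - n%:Z by rewrite OM_nrmM r1 mul1r.
  case: (OM_mul r a) => x y; rewrite /OM_nrm /= => nxy y0 xy.
  have [mx [kx hx]] := int_square_mod8 x; have [my [ky hy]] := int_square_mod8 y.
  have ey : y = 2 * my by lia.
  have [b [i ex]] : exists b : bool, exists i : nat, x = (if b then 1 else -1) * (2 * i%:Z + 1).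
    have [x0|x0] := leP 0 x; [exists true, `|mx|%N | exists false, `|(mx + 1)%R|%N]; lia.
  have xi : x ^+ 2 = (2 * i%:Z + 1) ^+ 2 by rewrite ex; case: b {ex} => /=; ring.
  have ib : (2 * i%:Z + 1) < 2 * y by move: xy; rewrite ex; case: b {ex}; lia.
  have [z ez] : exists z : nat, y = 2 * z.+1%:Z by exists (`|my|.-1)%N; lia.
  have nE : n%:Z = 24 * z.+1%:Z ^+ 2 - (2 * i%:Z + 1) ^+ 2.
    have -> : 24 * z.+1%:Z ^+ 2 = 6 * y ^+ 2 by rewrite ez; ring.
    by rewrite -xi; clear -nxy; lia.
  (* Hence n > 8 (z+1)^2, which bounds the block index by n and keeps the subtraction in [w]
     exact. *)
  have ib2 : (2 * i%:Z + 1) ^+ 2 < 16 * z.+1%:Z ^+ 2.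
    by rewrite ez in ib; clear -ib; nia.
  exists b, z, (z.+1, i); split.
  - clear -nE ib2; nia.
  - apply/mapP; exists i; last by congr pair; lia.
    by rewrite mem_iota; lia.
  - by rewrite /w /=; clear -nE ib2; lia.
  - by rewrite /phi /= ex ez.
- move=> b b' s s' [z i] [z' i'] r /mg /= [-> ih] /mg /= [-> ih'] r1 E.
  case: r r1 E => a c; rewrite /OM_nrm /OM_mul /phi /= => r1 [e1 e2].
  suff [-> ->] : a = 1 /\ c = 0 by [].
  apply: (pell_domain7 r1 (x := (if b then 1 else -1) * (2 * i%:Z + 1)) (y := 2 * s.+1%:Z)).
    by case: b {e1 e2} => /=; lia.
  by rewrite e1 e2; case: b' {e1 e2} => /=; lia.
Qed.

(** The form 5x + 12y is the first coordinate after multiplication by 5 + 2 sqrt 6, so the domain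
    lies between consecutive sign changes of x. For the image (x', y'): a, b > 0 gives x' > 0; a > 0
    > b gives 5x' + 12y' < 0; a < 0 gives y' < 0, which x' < 0 < 5x' + 12y' forbids. *)
Lemma pell_domain5_neg (a b x y : int) : a ^+ 2 - 6 * b ^+ 2 = 1 -> 2 <= b \/ b <= -2 ->
  x < 0 -> 0 < 5 * x + 12 * y -> a * x + 6 * (b * y) < 0 ->
  ~ 0 < 5 * (a * x + 6 * (b * y)) + 12 * (a * y + b * x).
Proof.
move=> E hb h1 h2 h3 h4.
have y0 : 0 < y by lia.
have E' : a ^+ 2 - 6 * (- b) ^+ 2 = 1 by rewrite sqrrN.
have E2 : (- a) ^+ 2 - 6 * b ^+ 2 = 1 by rewrite sqrrN.
have E3 : (- a) ^+ 2 - 6 * (- b) ^+ 2 = 1 by rewrite !sqrrN.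
have [a0|a0] := ltP 0 a.
  case: hb => hb.
    have [k1 k2] := pell_bounds E hb a0.
    have : 0 < a * (5 * x + 12 * y) by apply: mulr_gt0.
    have : 0 <= (5 * b - 2 * a) * y by apply: mulr_ge0; lia.
    lia.
  have [|k1 k2] := pell_bounds E' _ a0; first by lia.
  have : 0 < (5 * a + 12 * b) * - x by apply: mulr_gt0; lia.
  have : 0 <= (- 5 * b - 2 * a) * y by apply: mulr_ge0; lia.
  lia.
have a1 : 0 < - a by have := sqrf_eq0 a; nia.
have y1 : 0 < a * y + b * x by lia.
case: hb => hb.
  have : 0 < b * - x by apply: mulr_gt0; lia.
  have : 0 <= (- a) * y by apply: mulr_ge0; lia.
  lia.
have [|k1 k2] := pell_bounds E3 _ a1; first by lia.
have : 0 < (5 * - a - 12 * - b) * y by apply: mulr_gt0; lia.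
have : 0 < - b * (5 * x + 12 * y) by apply: mulr_gt0; lia.
lia.
Qed.

Lemma pell_domain5 (a b x y : int) : a ^+ 2 - 6 * b ^+ 2 = 1 ->
  x < 0 -> 0 < 5 * x + 12 * y -> a * x + 6 * (b * y) < 0 ->
  0 < 5 * (a * x + 6 * (b * y)) + 12 * (a * y + b * x) -> a = 1 /\ b = 0.
Proof.
move=> E h1 h2 h3 h4; have [[b0 [a1|a1]] //|hb] := pell_unit E.
  by exfalso; move: h3; rewrite b0 a1; lia.
by case: (pell_domain5_neg E hb h1 h2 h3).
Qed.

(* The values 8u^2 - 3v^2 with u = 3s+1 or 3s+2 and odd positive v such that 3v < 4u. *)
Definition norm_block5 (s : nat) : seq nat :=
  [seq (8 * u ^ 2 - 3 * i.*2.+1 ^ 2)%N | u <- [:: (3 * s).+1; (3 * s).+2], i <- iota 0 s.*2.+1].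

(* A pair (u, v) with v odd stands for the element 3v - 4u + (2u - v) sqrt 6 of norm
   3v^2 - 8u^2, and 3|v| < 4u says that it lies in the fundamental domain
   x < 0 < 5x + 12y for multiplication by 5 + 2 sqrt 6. *)
Lemma num_ideals5 n : (n %% 24 = 5)%N ->
  num_ideals n = (2 * \sum_(s < n.+1) count_mem n (norm_block5 s))%N.
Proof.
move=> n5.
have n0 : (0 < n)%N by case: n n5.
have on : odd n by lia.
pose g s := [seq (u, i) | u <- [:: (3 * s).+1; (3 * s).+2], i <- iota 0 s.*2.+1].
pose w (t : nat * nat) := (8 * t.1 ^ 2 - 3 * t.2.*2.+1 ^ 2)%N.
pose v (b : bool) (i : nat) : int := (if b then 1 else -1) * (2 * i%:Z + 1).
pose phi (b : bool) (t : nat * nat) : OM :=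
  (3 * v b t.2 - 4 * t.1%:Z, 2 * t.1%:Z - v b t.2).
have mg s t : t \in g s -> (t.1 = (3 * s).+1 \/ t.1 = (3 * s).+2) /\ (t.2 < s.*2.+1)%N.
  case/allpairsP => -[u i] []; rewrite mem_iota !inE => /orP /= hu hi -> /=.
  by split => //; case: hu => /eqP; [left|right].
have dom b s t : t \in g s -> (phi b t).1 < 0 /\ 0 < 5 * (phi b t).1 + 12 * (phi b t).2.
  by case: t => u i /mg /= [hu hi]; rewrite /phi /v; case: b => /=; lia.
have vsq b i : v b i ^+ 2 = (2 * i%:Z + 1) ^+ 2 by rewrite /v; case: b => /=; ring.
rewrite (@num_ideals_blocks n g w (fun t => t.1 %/ 3)%N phi) //.
- congr muln; apply: eq_bigr => s _.
  by rewrite /norm_block5 /g map_allpairs.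
- by move=> s; apply: allpairs_uniq; rewrite ?iota_uniq //= ?inE; [lia | move=> [? ?] [? ?] _ _].
- by move=> s [u i] /mg /= []; lia.
- move=> b b' [u i] [u' i']; rewrite /phi /= => -[] e1 e2.
  have eu : u = u' by lia.
  have ev : v b i = v b' i' by lia.
  by move: ev; rewrite /v eu; case: b b' {e1 e2} => [][] /= *; congr (_, (_, _)); lia.
- move=> b s [u i] tg; rewrite /w /= => <-.
  have -> : OM_nrm (phi b (u, i)) = 3 * (2 * i%:Z + 1) ^+ 2 - 8 * u%:Z ^+ 2.
    by rewrite -(vsq b) /phi /OM_nrm /=; ring.
  have {tg} /mg /= [hu hi] := tg.
  have : (3 * i.*2.+1 < 4 * u)%N by lia.
  clear; rewrite !expr2; nia.
- move=> a an.
  have na : OM_nrm a = - n%:Z.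
    have : OM_nrm a = n%:Z \/ OM_nrm a = - n%:Z by lia.
    case=> // e; exfalso; move: e; rewrite /OM_nrm; case: a {an} => x y /= e.
    have [mx [kx hx]] := int_square_mod8 x; have [my [ky hy]] := int_square_mod8 y.
    lia.
  have {na} [r [r1 [h1 [h2 na]]]] : exists r, OM_nrm r = 1 /\ (OM_mul r a).1 < 0 /\
      0 < 5 * (OM_mul r a).1 + 12 * (OM_mul r a).2 /\ OM_nrm (OM_mul r a) = - n%:Z.
    have [r [r1 [r2 r3]]] := OM_reduce on na.
    have nr : OM_nrm (OM_mul r a) = - n%:Z by rewrite OM_nrmM r1 mul1r.
    have [h|h] := ltP (OM_mul r a).1 0.
      by exists r; split => //; split => //; split => //; lia.
    (* For x > 0 the unit 5 - 2 sqrt 6 gives x' = 5x - 12y < 0, and 5x' + 12y' is x again. The value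
       x = 0 would make n even. *)
    exists (OM_mul (5, - 2) r); rewrite -OM_mulA !OM_nrmM r1 na.
    split; first by rewrite /OM_nrm /=; ring.
    have x0 : (OM_mul r a).1 != 0.
      by apply: contra_eq_neq nr => e; rewrite /OM_nrm e; lia.
    move: (OM_mul r a) r2 r3 h x0 => [x y] /= *; split; first by lia.
    by split; [lia | rewrite /OM_nrm /=; ring].
  exists r; split => //; move: na h1 h2.
  case: (OM_mul r a) => x y; rewrite /OM_nrm /= => nxy x0 xy0.
  have [mx [kx hx]] := int_square_mod8 x; have [my [ky hy]] := int_square_mod8 y.
  have ox : x = 2 * mx + 1 by lia.
  have oy : y = 2 * my + 1 by lia.
  (* As n is 2 mod 3, x is prime to 3; since 2u = x + 3y below, so is u, which leaves 3s+1 and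
     3s+2. *)
  have x3 : exists m, x = 3 * m + 1 \/ x = 3 * m + 2.
    exists (x %/ 3)%Z; have [e|[e|e]] : x = 3 * (x %/ 3)%Z \/ x = 3 * (x %/ 3)%Z + 1 \/
      x = 3 * (x %/ 3)%Z + 2 by lia.
    2: by left. 2: by right.
    move: (x %/ 3)%Z e => m e; exfalso.
    have : x ^+ 2 = 9 * m ^+ 2 by rewrite e; ring.
    lia.
  (* Inverse change of variables: 2u = x + 3y and v = x + 2y, with x and y both odd. *)
  have [u eu] : exists u : nat, x + 3 * y = 2 * u%:Z by exists `|(mx + 3 * my + 2)%R|%N; lia.
  have [b [i ev]] : exists b i, x + 2 * y = v b i.
    have [v0|v0] := leP 0 (x + 2 * y).
      by exists true, `|(mx + 2 * my + 1)%R|%N; rewrite /v; lia.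
    by exists false, `|(mx + 2 * my + 2)%R|%N; rewrite /v; lia.
  have i3 : (3 * i.*2.+1 < 4 * u)%N by move: ev; rewrite /v; case: b; lia.
  have nE : n%:Z = 8 * u%:Z ^+ 2 - 3 * (2 * i%:Z + 1) ^+ 2.
    rewrite -(vsq b) -ev -[LHS]opprK -nxy.
    have -> : 8 * u%:Z ^+ 2 = 2 * (2 * u%:Z) ^+ 2 by ring.
    by rewrite -eu; ring.
  exists b, (u %/ 3)%N, (u, i); split.
  - clear -nE i3; rewrite !expr2 in nE; nia.
  - apply/allpairsP; exists (u, i); split => //; last by rewrite mem_iota /=; lia.
    by rewrite !inE /=; lia.
  - by rewrite /w /=; clear -nE i3; rewrite !expr2 in nE; nia.
  - by rewrite /phi /= -ev; congr pair; lia.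
- move=> b b' s s' t t' r /dom - /(_ b)[d1 d2] /dom - /(_ b')[d3 d4] r1 E.
  case: r r1 E => a c; rewrite /OM_nrm /= => r1 E.
  suff [-> ->] : a = 1 /\ c = 0 by [].
  by apply: (pell_domain5 r1 d1 d2); rewrite -E in d3 d4.
Qed.

(** * Convergence *)

Section ComplexLimits.
Import Normc.
Variable R : realType.
Local Notation C := R[i].
Local Notation nc := (@Normc.normc R).

Lemma normc_ge0 (x : C) : 0 <= nc x.
Proof. by case: x => a b; exact: sqrtr_ge0. Qed.

Lemma normcD (x y : C) : nc (x + y) <= nc x + nc y.
Proof. exact: (@le_normcD R x y). Qed.

Lemma normc_opp (x : C) : nc (- x) = nc x.
Proof. exact: (@normcN R x). Qed.

Lemma normcX (x : C) n : nc (x ^+ n) = nc x ^+ n.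
Proof. by elim: n => [|n IH]; rewrite ?expr0 ?normc1 // !exprS normcM IH. Qed.

Lemma normcB (x y : C) : nc (x - y) <= nc x + nc y.
Proof. by rewrite -(normc_opp y); exact: normcD. Qed.

Lemma normc_gt0 (x : C) : x != 0 -> 0 < nc x.
Proof.
move=> x0; rewrite lt_neqAle normc_ge0 andbT eq_sym.
by apply: contra_neq x0 => /eq0_normc.
Qed.

Lemma normc_sum (I : Type) (r : seq I) (P : pred I) (F : I -> C) :
  nc (\sum_(i <- r | P i) F i) <= \sum_(i <- r | P i) nc (F i).
Proof.
elim/big_ind2: _ => [|x u y v xu yv|//]; first by rewrite normc0.
by apply: le_trans (normcD _ _) _; apply: lerD.
Qed.

Lemma normc_Re (x : C) : `|complex.Re x| <= nc x.
Proof. by case: x => a b /=; rewrite -sqrtr_sqr ler_sqrt ?addr_ge0 ?sqr_ge0 // lerDl sqr_ge0. Qed.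

Lemma normc_Im (x : C) : `|complex.Im x| <= nc x.
Proof. by case: x => a b /=; rewrite -sqrtr_sqr ler_sqrt ?addr_ge0 ?sqr_ge0 // lerDr sqr_ge0. Qed.

Lemma normc_le_ReIm (x : C) : nc x <= `|complex.Re x| + `|complex.Im x|.
Proof.
case: x => a b /=; rewrite -[leRHS]ger0_norm ?addr_ge0 // -sqrtr_sqr ler_sqrt ?sqr_ge0 //.
by rewrite sqrrD !real_normK ?num_real // -addrA addrCA lerDr mulrn_wge0 // mulr_ge0.
Qed.

Local Open Scope classical_set_scope.

Lemma cconv_le (u : nat -> C) l (v : nat -> R) :
  (forall N, nc (u N - l) <= v N) -> v @ \oo --> (0 : R) -> cconv u l.
Proof.
move=> uv v0; apply: (squeeze_cvgr _ (cvg_cst 0) v0).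
by near=> N; rewrite normc_ge0 uv.
Unshelve. all: by end_near.
Qed.

Lemma cconv_near (u v : nat -> C) l (e : nat -> R) : cconv v l ->
  (forall N, nc (u N - v N) <= e N) -> e @ \oo --> (0 : R) -> cconv u l.
Proof.
move=> vl uv e0; apply: (@cconv_le _ _ (fun N => e N + nc (v N - l))).
  move=> N; have -> : u N - l = (u N - v N) + (v N - l) by rewrite addrA subrK.
  by apply: le_trans (normcD _ _) _; rewrite lerD2r.
by rewrite -[X in _ --> X]addr0; apply: cvgD.
Qed.

Lemma cconvD (u v : nat -> C) l m : cconv u l -> cconv v m ->
  cconv (fun N => u N + v N) (l + m).
Proof.
move=> ul vm; apply: (@cconv_le _ _ (fun N => nc (u N - l) + nc (v N - m))).
  by move=> N; rewrite opprD addrACA; exact: normcD.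
by rewrite -[X in _ --> X]addr0; apply: cvgD.
Qed.

Lemma cconvZ (c : C) (u : nat -> C) l : cconv u l -> cconv (fun N => c * u N) (c * l).
Proof.
move=> ul; apply: (@cconv_le _ _ (fun N => nc c * nc (u N - l))).
  by move=> N; rewrite -mulrBr normcM.
by rewrite -[X in _ --> X](mulr0 (nc c)); apply: cvgM => //; exact: cvg_cst.
Qed.

Lemma cconv_cst (c : C) : cconv (fun=> c) c.
Proof.
by apply: (@cconv_le _ _ (fun=> 0)) => [N|]; [rewrite subrr normc0 | exact: cvg_cst].
Qed.

Lemma cconv_subseq (h : nat -> nat) (u : nat -> C) l : (forall N, (N <= h N)%N) ->
  cconv u l -> cconv (fun N => u (h N)) l.
Proof.
move=> hN ul; apply: (@cvg_comp _ _ _ h (fun N => nc (u N - l)) _ \oo) => //.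
apply/cvgnyPge => A; near=> N; apply: leq_trans (hN N).
by near: N; exact: nbhs_infty_ge.
Unshelve. all: by end_near.
Qed.

Lemma cvg_bounded_geometric (K s : R) : 0 <= s < 1 -> (fun N => K * s ^+ N) @ \oo --> (0 : R).
Proof. by move=> /andP[s0 s1]; apply: cvg_geometric; rewrite ger0_norm. Qed.

Lemma csums_exists (u : nat -> C) (K s : R) : 0 <= s < 1 ->
  (forall n, nc (u n) <= K * s ^+ n) -> exists l, csums u l.
Proof.
move=> /andP[s0 s1] uK.
have real_cvg (f : nat -> R) : (forall n, `|f n| <= nc (u n)) ->
    cvgn (series f).
  move=> fu; apply: normed_cvg; apply: (@series_le_cvg _ _ (fun n => K * s ^+ n)).
  - by move=> n; rewrite normr_ge0.
  - by move=> n; apply: le_trans (uK n); apply: normc_ge0.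
  - by move=> n; apply: le_trans (fu n) (uK n).
  - by apply: is_cvg_geometric_series; rewrite ger0_norm.
have cR := real_cvg _ (fun n => normc_Re (u n)).
have cI := real_cvg _ (fun n => normc_Im (u n)).
have dist0 (f : nat -> R) : cvgn (series f) ->
    (fun N => `|series f N - limn (series f)|) @ \oo --> (0 : R).
  move=> cf; rewrite -(normr0 R) -(subrr (limn (series f))).
  by apply: cvg_norm; apply: cvgB => //; exact: cvg_cst.
exists (Complex (limn (series (fun n => complex.Re (u n))))
                (limn (series (fun n => complex.Im (u n))))).
apply: (@cconv_le _ _ (fun N =>
   `|series (fun n => complex.Re (u n)) N - limn (series (fun n => complex.Re (u n)))| +
   `|series (fun n => complex.Im (u n)) N - limn (series (fun n => complex.Im (u n)))|)).
  move=> N; apply: le_trans (normc_le_ReIm _) _.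
  have eRe : complex.Re (\sum_(n < N) u n) = series (fun n => complex.Re (u n)) N.
    by rewrite /series /= big_mkord; apply: big_morph => // -[a b] [c d].
  have eIm : complex.Im (\sum_(n < N) u n) = series (fun n => complex.Im (u n)) N.
    by rewrite /series /= big_mkord; apply: big_morph => // -[a b] [c d].
  by rewrite -eRe -eIm; case: (\sum_(n < N) u n).
by rewrite -[X in _ --> X]addr0; apply: cvgD; exact: dist0.
Qed.

End ComplexLimits.

Section Geometric.
Variable R : realType.

(** Each of the n + 1 terms s^i with i <= n is at least s^n. *)
Lemma natmul_geometric (s : R) n : 0 <= s < 1 -> n.+1%:R * s ^+ n <= (1 - s)^-1.
Proof.
move=> /andP[s0 s1]; have s1' : 0 < 1 - s by rewrite subr_gt0.
rewrite -[leRHS]mul1r ler_pdivlMr //.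
apply: (@le_trans _ _ ((\sum_(i < n.+1) s ^+ i) * (1 - s))).
  apply: ler_wpM2r; first exact: ltW.
  rewrite mulr_natl -[n.+1 in leLHS]card_ord -sumr_const.
  apply: ler_sum => -[i iN] _ /=; apply: ler_wiXn2l => //; exact: ltW.
have -> : (\sum_(i < n.+1) s ^+ i) * (1 - s) = 1 - s ^+ n.+1.
  by rewrite -opprB mulrN mulrC -subrX1 opprB.
by rewrite gerBl exprn_ge0.
Qed.

(** Each factor n + 1 is paid for by replacing the ratio by its square root. *)
Lemma poly_geometric (k : nat) (s : R) : 0 <= s < 1 -> exists K t : R,
  [/\ 0 <= K, 0 <= t < 1 & forall n, n.+1%:R ^+ k * s ^+ n <= K * t ^+ n].
Proof.
move=> s01; elim: k => [|k [K [t [K0 /andP[t0 t1] H]]]].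
  by exists 1, s; split => // n; rewrite expr0.
have r0 : 0 <= Num.sqrt t < 1.
  by rewrite sqrtr_ge0 -(sqrtr1 R) ltr_sqrt.
exists (K * (1 - Num.sqrt t)^-1), (Num.sqrt t); split => //.
  by rewrite mulr_ge0 // invr_ge0 subr_ge0; case/andP: r0 => _ /ltW.
move=> n; rewrite exprS -mulrA; apply: le_trans (ler_wpM2l _ (H n)) _ => //.
rewrite mulrCA -mulrA ler_wpM2l // -[in leLHS](sqr_sqrtr t0) -exprM mulnC exprM expr2 mulrA.
by rewrite ler_wpM2r ?exprn_ge0 ?sqrtr_ge0 // natmul_geometric.
Qed.

End Geometric.

Section Bounds.
Import Normc.
Variable R : realType.
Local Notation C := R[i].
Local Notation nc := (@Normc.normc R).

Lemma geometric_sum_le (s : R) n : 0 <= s < 1 -> \sum_(k < n) s ^+ k <= (1 - s)^-1.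
Proof.
move=> /andP[s0 s1]; rewrite -[leRHS]mul1r ler_pdivlMr ?subr_gt0 //.
rewrite mulrC -[1 - s]opprB mulNr -subrX1 opprB.
by rewrite gerBl exprn_ge0.
Qed.

Lemma one_sub_neq0 (x : C) : nc x < 1 -> 1 - x != 0.
Proof. by apply: contraTneq => /subr0_eq <-; rewrite normc1 ltxx. Qed.

Lemma normcX_lt1 (x : C) n : nc x < 1 -> nc (x ^+ n.+1) < 1.
Proof. by move=> x1; rewrite normcX exprn_ilt1 // normc_ge0. Qed.

Lemma one_sub_expr_neq0 (x : C) n : nc x < 1 -> 1 - x ^+ n.+1 != 0.
Proof. by move=> x1; rewrite one_sub_neq0 // normcX_lt1. Qed.

Lemma qfact_le (x : C) n : nc x < 1 -> nc (qprod x x n) <= expR (1 - nc x)^-1.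
Proof.
move=> x1; apply: (@le_trans _ _ (expR (\sum_(k < n) nc x ^+ k))); last first.
  by rewrite ler_expR geometric_sum_le // normc_ge0.
elim: n => [|n IH]; first by rewrite qprod0 normc1 big_ord0 expR0.
rewrite qprodS normcM big_ord_recr /= expRD.
apply: ler_pM; rewrite ?normc_ge0 //.
apply: le_trans (expR_ge1Dx _); apply: le_trans (normcB _ _) _.
rewrite normc1 lerD2l -exprS normcX; apply: ler_wiXn2l; rewrite ?normc_ge0 //.
exact: ltW.
Qed.

(** With y = |x| and t = y^k, each factor satisfies 1 / (1 - y t) <= 1 + t / (1 - y) <= exp (t / (1
    - y)), and the exponents sum to a geometric series. *)
Lemma qfact_inv_le (x : C) n : nc x < 1 ->
  (nc (qprod x x n))^-1 <= expR ((1 - nc x)^-1 * (1 - nc x)^-1).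
Proof.
move=> x1; have d0 : 0 < 1 - nc x by rewrite subr_gt0.
apply: (@le_trans _ _ (expR (\sum_(k < n) nc x ^+ k / (1 - nc x)))); last first.
  rewrite ler_expR -mulr_suml ler_wpM2r ?invr_ge0 ?(ltW d0) //.
  by rewrite geometric_sum_le // normc_ge0.
elim: n => [|n IH]; first by rewrite qprod0 normc1 big_ord0 expR0 invr1.
rewrite qprodS normcM big_ord_recr /= expRD invfM.
apply: ler_pM; rewrite ?invr_ge0 ?normc_ge0 //.
apply: le_trans (expR_ge1Dx _).
set t := nc x ^+ n; rewrite -exprS.
have tx : nc (x ^+ n.+1) <= nc x * t by rewrite normcX exprS.
have t0 : 0 <= t by rewrite exprn_ge0 // normc_ge0.
have t1 : t <= 1 by rewrite exprn_ile1 ?normc_ge0 // ltW.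
have lb : 1 - nc x * t <= nc (1 - x ^+ n.+1).
  have := normcD (1 - x ^+ n.+1) (x ^+ n.+1); rewrite subrK normc1; lra.
have xt : nc x * t <= nc x by rewrite ler_piMr ?normc_ge0.
have d1 : 0 < 1 - nc x * t by lra.
apply: le_trans (_ : _ <= (1 - nc x * t)^-1) _.
  by rewrite lef_pV2 // posrE // (lt_le_trans d1).
rewrite -[leLHS]mul1r ler_pdivrMr //.
have : t / (1 - nc x) * (1 - nc x) = t by rewrite mulfVK // gt_eqF.
have : 0 <= t / (1 - nc x) by rewrite divr_ge0 // ltW.
have y0 := normc_ge0 x; move: (t / (1 - nc x)) => u u0 ut.
have h1 : 0 <= u * (1 - nc x) ^+ 2 by rewrite mulr_ge0 ?sqr_ge0.
have h2 : 0 <= u * (nc x * (1 - t)) by rewrite !mulr_ge0 // subr_ge0.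
have h3 : nc x * (u * (1 - nc x)) = nc x * t by rewrite ut.
lra.
Qed.

Variable q : C.
Hypothesis q_lt1 : nc q < 1.

Lemma qfact_bounds : exists D : R, 1 <= D /\ forall n,
  nc (qprod q q n)^-1 <= D /\ nc (even_qfact q n) <= D.
Proof.
have q2 := normcX_lt1 1 q_lt1.
exists (1 + expR ((1 - nc q)^-1 * (1 - nc q)^-1) + expR (1 - nc (q ^+ 2))^-1).
have e0 (x : R) := expR_ge0 x; split => [|n].
  by rewrite -addrA lerDl addr_ge0.
rewrite normcV; split.
  apply: le_trans (qfact_inv_le n q_lt1) _.
  by rewrite addrAC lerDr addr_ge0.
apply: le_trans (qfact_le n q2) _.
by rewrite lerDr addr_ge0.
Qed.

Lemma inv_qfact_le (D : R) m s : 1 <= D ->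
  (forall n, nc (qprod q q n)^-1 <= D /\ nc (even_qfact q n) <= D) ->
  nc (inv_qfact q m s) <= D.
Proof.
move=> D1 HD; rewrite /inv_qfact; case: ifP => _; first by case: (HD (m - s)%N).
by rewrite normc0 (le_trans ler01).
Qed.

Hypothesis q_neq0 : q != 0.

Let q_neq1 k : 1 - q ^+ k.+1 != 0. Proof. exact: one_sub_expr_neq0. Qed.

Let nq0 : 0 < nc q. Proof. exact: normc_gt0. Qed.

(** The gain from averaging. With a = q^(M+1-r) and b = q^(M+r+1), two consecutive edges over a
    common denominator leave (1 - ab) - (1 - a)(1 - b) = a + b - 2ab, of size |q|^(M-r). *)
Lemma gamma0_edge_bound : exists2 K : R, 0 <= K & forall M r,
  nc (gamma0_edge q M r + gamma0_edge q M.+1 r) <= K * nc q ^+ M / nc q ^+ r.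
Proof.
have [D [D1 HD]] := qfact_bounds.
have D0 : 0 <= D by exact: le_trans ler01 D1.
exists (D * D * D * 4); first by rewrite !mulr_ge0.
move=> M r; have [rM|Mr] := leqP r M.+1; last first.
  rewrite /gamma0_edge !inv_qfact_small //; last exact: ltnW.
  rewrite !(mulr0, mul0r) addr0 normc0 mulr_ge0 ?invr_ge0 ?exprn_ge0 ?normc_ge0 //.
  by rewrite !mulr_ge0 // exprn_ge0 // normc_ge0.
set a := q ^+ (M.+1 - r); set b := q ^+ (M + r).+1.
have ab : q ^+ M.+1 ^+ 2 = a * b by rewrite -exprM -exprD; congr (_ ^+ _); lia.
have -> : gamma0_edge q M r + gamma0_edge q M.+1 r = (-1) ^+ M * even_qfact q M *
    inv_qfact q M.+1 r * (qprod q q (M + r).+1)^-1 * (a + b - a * b - a * b).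
  rewrite /gamma0_edge -(inv_qfactS q_neq1) (even_qfactS q M) ab addSn qfactS -/a -/b exprS.
  have h1 := qfact_neq0 q_neq1 (M + r); have h2 := q_neq1 (M + r).
  rewrite -/b in h2; clearbody a b; move: (inv_qfact _ _ _) (even_qfact _ _) => J E.
  by field; rewrite h1 h2.
have [_ HE] := HD M; have [Hf _] := HD (M + r).+1.
have HJ := inv_qfact_le M.+1 r D1 HD.
have na : nc a = nc q ^+ M.+1 / nc q ^+ r.
  by rewrite /a normcX -expfB_cond // gt_eqF.
have a0 := normc_ge0 a; have b0 := normc_ge0 b.
have b1 : nc b <= 1 by rewrite /b normcX exprn_ile1 ?normc_ge0 // ltW.
have ba : nc b <= nc a.
  have -> : b = a * q ^+ r.*2 by rewrite -exprD; congr (_ ^+ _); lia.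
  by rewrite normcM ler_piMr // normcX exprn_ile1 ?normc_ge0 // ltW.
have ab4 : nc (a + b - a * b - a * b) <= 4 * nc a.
  apply: le_trans (normcB _ _) _; apply: le_trans (lerD (normcB _ _) (lexx _)) _.
  apply: le_trans (lerD (lerD (normcD _ _) (lexx _)) (lexx _)) _.
  rewrite normcM; have : nc a * nc b <= nc a by rewrite ler_piMr.
  lra.
have aM : nc a <= nc q ^+ M / nc q ^+ r.
  rewrite na ler_wpM2r ?invr_ge0 ?exprn_ge0 ?normc_ge0 //.
  by rewrite exprS ler_piMl ?exprn_ge0 ?normc_ge0 // ltW.
rewrite !normcM normcX normc_opp normc1 expr1n mul1r -[leRHS]mulrA -[leRHS]mulrA.
do !apply: ler_pM; rewrite ?mulr_ge0 ?normc_ge0 //.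
by apply: le_trans ab4 _; rewrite ler_wpM2l.
Qed.

Lemma gamma1_edge_bound : exists2 K : R, 0 <= K & forall N r,
  nc (gamma1_edge q N r) <= K * nc q ^+ N / nc q ^+ r.
Proof.
have [D [D1 HD]] := qfact_bounds.
have D0 : 0 <= D by exact: le_trans ler01 D1.
exists (2 * (nc q)^-1 * D * D * D); first by rewrite !mulr_ge0 ?invr_ge0 // ltW.
move=> N r; rewrite /gamma1_edge.
have [_ HE] := HD N; have [Hf _] := HD (N + r).+1.
have HJ := inv_qfact_le N r D1 HD.
have r1 : nc q ^+ r <= 1 by rewrite exprn_ile1 ?normc_ge0 // ltW.
have r0 : 0 < nc q ^+ r by rewrite exprn_gt0.
have H1 : nc (q ^- r - q ^+ r.+1) <= 2 / nc q ^+ r.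
  apply: le_trans (normcB _ _) _; rewrite normcV !normcX.
  have : nc q ^+ r.+1 <= 1 by rewrite exprn_ile1 ?normc_ge0 // ltW.
  have : 1 <= (nc q ^+ r)^-1 by rewrite invf_ge1.
  lra.
rewrite !normcM normc_opp normcX normc_opp normcV.
have -> : 2 * (nc q)^-1 * D * D * D * nc q ^+ N / nc q ^+ r =
  2 / nc q ^+ r * nc q ^+ N * (nc q)^-1 * D * D * D by ring.
have ? : 0 <= (nc q)^-1 by rewrite invr_ge0 ltW.
have ? : 0 <= nc q ^+ N by rewrite exprn_ge0 // ltW.
by do !apply: ler_pM; rewrite ?mulr_ge0 ?normc_ge0 // -?normcV.
Qed.

(** Up to sign u_s is an alternating sum of s + 1 errors, whose bounds increase with s, so the last
    bound serves for all. *)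
Lemma alternating_recursion_bound (u : nat -> C) (y : R) : 0 <= y -> nc (u 0%N) <= y ->
  (forall s, nc (u s.+1 + u s) <= y / nc q ^+ s.+1) ->
  forall s, nc (u s) <= s.+1%:R * (y / nc q ^+ s).
Proof.
move=> y0 u0 uS; elim=> [|s IH]; first by rewrite expr0 divr1 mul1r.
have -> : u s.+1 = (u s.+1 + u s) - u s by rewrite addrK.
apply: le_trans (normcB _ _) _; apply: le_trans (lerD (uS s) IH) _.
rewrite -[s.+2]add1n natrD mulrDl mul1r lerD2l.
apply: ler_wpM2l => //; apply: ler_wpM2l => //.
rewrite lef_pV2 ?posrE ?exprn_gt0 // exprS ler_piMl ?exprn_ge0 ?normc_ge0 //.
exact: ltW.
Qed.

End Bounds.

(** * Distance from the truncated sums to the theta series *)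

Section HeckeSums.
Import Normc.
Variable R : realType.
Local Notation C := R[i].
Local Notation nc := (@Normc.normc R).

(** Alpha times the ideal value (-1)^s of the sum of two consecutive truncations of gamma. In
    [theta_sum1], alpha times (-1)^s / (q [gamma1_weight]) adds 2s to the exponents of
    [bailey_alpha1E]. *)
Definition theta_sum0 (p : C) (s : nat) : C :=
  \sum_(i < s.*2.+1) (p ^+ (3 * s ^ 2 + 2 * s - 'C(i.+1, 2)) +
                     p ^+ (3 * s ^ 2 + 4 * s + 1 - 'C(i.+1, 2))).

Definition theta_sum1 (p : C) (s : nat) : C :=
  \sum_(i < s.*2.+2) p ^+ (3 * s ^ 2 + 6 * s + 1 - 'C(i.+1, 2)).

Variable p : C.
Hypothesis p_lt1 : nc p < 1.
Hypothesis p_neq0 : p != 0.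

Local Notation q := (p ^+ 2).

Let q_lt1 : nc q < 1. Proof. exact: normcX_lt1. Qed.
Let q_neq0 : q != 0. Proof. by rewrite expf_neq0. Qed.
Let q_neq1 k : 1 - q ^+ k.+1 != 0. Proof. exact: one_sub_expr_neq0. Qed.
Let p_neq1 k : 1 - p ^+ k.+1 != 0. Proof. exact: one_sub_expr_neq0. Qed.
Let np_le1 : nc p <= 1. Proof. exact: ltW. Qed.
Let nq_le1 : nc q <= 1. Proof. exact: ltW. Qed.
Let nq_gt0 : 0 < nc q. Proof. exact: normc_gt0. Qed.

Let nq_pow s : nc q ^+ s = nc p ^+ (2 * s). Proof. by rewrite normcX -exprM. Qed.

Definition double_sum_term (e n : nat) : C :=
  (- q ^+ e) ^+ n * even_qfact q n *
  \sum_(l < n.+1) bailey_beta_coef q p l * inv_qfact q n l.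

Lemma sum_double_sum_term e N : \sum_(n < N) double_sum_term e n =
  \sum_(s < N) bailey_alpha q p e s * gamma_sum q e N s.
Proof.
exact: (bailey_transform q_neq0 q_neq1 e (bailey_beta_coef q p)
  (fun n => (- q ^+ e) ^+ n * even_qfact q n) N).
Qed.

Lemma gamma_sum_diag e N : gamma_sum q e N N = 0.
Proof.
rewrite /gamma_sum big1 // => m _.
by rewrite inv_qfact_small // mul0r mulr0.
Qed.

Lemma normc_pow_le a b : (b <= a)%N -> nc (p ^+ a) <= nc p ^+ b.
Proof. by move=> ba; rewrite normcX ler_wiXn2l ?normc_ge0. Qed.

Lemma sum_gap_le s N (F : 'I_N -> C) : (forall i, nc (F i) <= nc q ^+ s) ->
  nc (\sum_(i < N) F i) <= N%:R * nc q ^+ s.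
Proof.
move=> Fq; apply: le_trans (normc_sum _ _ _) _.
apply: le_trans (ler_sum _ (fun i _ => Fq i)) _.
by rewrite sumr_const card_ord mulr_natl.
Qed.

(** The smallest exponent, at i = 2s, is s^2 + s >= 2s. The resulting |q|^s absorbs the |q|^(-s) of
    the edge bounds. *)
Lemma theta_sum0_le s : nc (theta_sum0 p s) <= 4 * s.+1%:R * nc q ^+ s.
Proof.
rewrite /theta_sum0 big_split /=; apply: le_trans (normcD _ _) _.
have E (a : nat) : (3 * s ^ 2 + 2 * s <= a)%N ->
    nc (\sum_(i < s.*2.+1) p ^+ (a - 'C(i.+1, 2))) <= s.*2.+1%:R * nc q ^+ s.
  move=> ha; apply: sum_gap_le => -[i iM] /=; rewrite nq_pow; apply: normc_pow_le.
  have := leq_bin2l 2 iM; have := bin2D s.*2.+1; nia.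
apply: le_trans (lerD (E _ _) (E _ _)) _ => //; first by lia.
rewrite -mulrDl; apply: ler_wpM2r; first by rewrite exprn_ge0 ?normc_ge0.
by rewrite -natrD -natrM ler_nat; lia.
Qed.

Lemma theta_sum1_gap s :
  nc (\sum_(i < s.*2.+2) p ^+ (3 * s ^ 2 + 4 * s + 1 - 'C(i.+1, 2))) <=
  2 * s.+1%:R * nc q ^+ s.
Proof.
have -> : 2 * s.+1%:R = s.*2.+2%:R :> R by rewrite -natrM; congr (_%:R); lia.
apply: sum_gap_le => -[i iM] /=; rewrite nq_pow; apply: normc_pow_le.
have := leq_bin2l 2 iM; have := bin2D s.*2.+2; nia.
Qed.

Lemma sum_cubic_le N (F : nat -> C) (K : R) : 0 <= K ->
  (forall s, nc (F s) <= K * s.+1%:R ^+ 2) ->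
  nc (\sum_(s < N) F s) <= K * N%:R ^+ 3.
Proof.
move=> K0 FK; apply: le_trans (normc_sum _ _ _) _.
apply: (@le_trans _ _ (\sum_(s < N) K * N%:R ^+ 2)).
  apply: ler_sum => -[s sN] _ /=; apply: le_trans (FK s) _.
  by apply: ler_wpM2l => //; rewrite lerXn2r ?nnegrE ?ler0n // ler_nat.
by rewrite sumr_const card_ord -[leLHS]mulr_natl mulrCA -exprS.
Qed.

(** The difference is the sum of alpha_s u_s, with u_s the deviation of gamma. The recurrence makes
    u_s of size (s+1) |q|^(N-s), so each product is at most 4K (s+1)^2 |q|^N. *)
Lemma double_sum0_error : exists2 K : R, 0 <= K & forall N,
  nc (\sum_(n < N) double_sum_term 0 n + \sum_(n < N.+1) double_sum_term 0 n -
      \sum_(s < N.+1) theta_sum0 p s) <= K * (N.+1%:R ^+ 3 * nc q ^+ N).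
Proof.
have [K K0 HK] := gamma0_edge_bound q_lt1 q_neq0.
exists (4 * K); first by rewrite mulr_ge0.
move=> N; set y := K * nc q ^+ N.
have y0 : 0 <= y by rewrite mulr_ge0 // exprn_ge0 // normc_ge0.
pose u s := gamma_sum q 0 N s + gamma_sum q 0 N.+1 s - (-1) ^+ s.
have u_le s : nc (u s) <= s.+1%:R * (y / nc q ^+ s).
  apply: (alternating_recursion_bound q_lt1 q_neq0) => // [|r].
    have -> : u 0%N = (gamma0_edge q N 0 + gamma0_edge q N.+1 0) / 2.
      have h1 := gamma0_base q_neq1 N; have h2 := gamma0_base q_neq1 N.+1.
      apply: (@mulIf _ (2 : C)); first by rewrite pnatr_eq0.
      rewrite mulfVK ?pnatr_eq0 // /u expr0 mulrC mulrBr mulrDr h1 h2; ring.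
    have := HK N 0%N; rewrite expr0 divr1 -/y normcM normcV => h.
    have -> : nc 2 = 2.
      by rewrite /Normc.normc /= !addr0 expr0n addr0 sqrtr_sqr ger0_norm.
    rewrite ler_pdivrMr // (le_trans h) //; lra.
  have -> : u r.+1 + u r = gamma0_edge q N r.+1 + gamma0_edge q N.+1 r.+1.
    rewrite -!(gamma0_step q_neq0 q_neq1) /u [(-1) ^+ r.+1]exprS; ring.
  exact: HK.
have -> : \sum_(n < N) double_sum_term 0 n + \sum_(n < N.+1) double_sum_term 0 n -
      \sum_(s < N.+1) theta_sum0 p s = \sum_(s < N.+1) bailey_alpha q p 0 s * u s.
  (* The entry s = N of gamma truncated at N vanishes, so both sums can run over s < N+1. *)
  have -> : \sum_(n < N) double_sum_term 0 n =
      \sum_(s < N.+1) bailey_alpha q p 0 s * gamma_sum q 0 N s.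
    by rewrite big_ord_recr /= gamma_sum_diag mulr0 addr0 sum_double_sum_term.
  rewrite sum_double_sum_term -big_split -sumrB; apply: eq_bigr => s _ /=.
  rewrite /u mulrBr mulrDr; congr (_ - _).
  by rewrite (bailey_alpha0E q_neq0 q_neq1 (erefl q) p_neq1) mulrAC -expr2 -exprM mulnC exprM
     sqrrN expr1n expr1n mul1r.
have -> : 4 * K * (N.+1%:R ^+ 3 * nc q ^+ N) = 4 * y * N.+1%:R ^+ 3 by rewrite /y; ring.
apply: (@sum_cubic_le N.+1 (fun s => bailey_alpha q p 0 s * u s)); first by rewrite mulr_ge0.
move=> s; rewrite normcM (bailey_alpha0E q_neq0 q_neq1 (erefl q) p_neq1) normcM.
rewrite normcX normc_opp normc1 expr1n mul1r.
apply: le_trans (ler_pM (normc_ge0 _) (normc_ge0 _) (theta_sum0_le s) (u_le s)) _.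
have q0 : nc q ^+ s != 0 by rewrite expf_neq0 // gt_eqF.
by move: (nc q ^+ s) q0 => z z0; rewrite le_eqVlt; apply/orP; left; apply/eqP; field.
Qed.

Lemma double_sum1_error : exists2 K : R, 0 <= K & forall N,
  nc (\sum_(n < N) double_sum_term 1 n - \sum_(s < N) theta_sum1 p s) <=
  K * (N.+1%:R ^+ 3 * nc q ^+ N).
Proof.
have [K K0 HK] := gamma1_edge_bound q_lt1 q_neq0.
exists (2 * K); first by rewrite mulr_ge0.
move=> N; set y := K * nc q ^+ N.
have y0 : 0 <= y by rewrite mulr_ge0 // exprn_ge0 // normc_ge0.
pose u s := gamma_sum q 1 N s * gamma1_weight q s - (-1) ^+ s / q.
have u_le s : nc (u s) <= s.+1%:R * (y / nc q ^+ s).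
  apply: (alternating_recursion_bound q_lt1 q_neq0) => // [|r].
    have -> : u 0%N = gamma1_edge q N 0.
      by rewrite /u (gamma1_base q_neq0 q_neq1) expr0 div1r addrAC subrr add0r.
    by have := HK N 0%N; rewrite expr0 divr1.
  have -> : u r.+1 + u r = gamma1_edge q N r.+1.
    rewrite -(gamma1_step q_neq0 q_neq1) /u [(-1) ^+ r.+1]exprS; ring.
  exact: HK.
pose A s := \sum_(i < s.*2.+2) p ^+ (3 * s ^ 2 + 4 * s + 1 - 'C(i.+1, 2)).
have -> : \sum_(n < N) double_sum_term 1 n - \sum_(s < N) theta_sum1 p s =
    \sum_(s < N) (-1) ^+ s * A s * q ^+ s.+1 * u s.
  rewrite sum_double_sum_term -sumrB; apply: eq_bigr => s _ /=.
  rewrite (bailey_alpha1E q_neq0 q_neq1 (erefl q) p_neq1) -/(A s).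
  have -> : theta_sum1 p s = q ^+ s * A s.
    rewrite /theta_sum1 /A mulr_sumr; apply: eq_bigr => -[i iM] _ /=.
    rewrite -exprM -exprD; congr (_ ^+ _).
    have := leq_bin2l 2 iM; have := bin2D s.*2.+2; nia.
  have s1 : (-1) ^+ s * (-1) ^+ s = 1 :> C by rewrite -expr2 -exprM mulnC exprM sqrrN !expr1n.
  rewrite /u /gamma1_weight -addnn [q ^+ (_ + _)]exprD [q ^+ s.+1]exprS.
  have qs : q ^+ s != 0 by rewrite expf_neq0.
  have -> : q ^+ s * A s = (-1) ^+ s * (-1) ^+ s * (q ^+ s * A s) by rewrite s1 mul1r.
  clear s1; move: (q ^+ s) qs (A s) (gamma_sum _ _ _ _) ((-1) ^+ s) => Q Q0 a g sg.
  move: (p ^+ 2) q_neq0 => z z0.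
  by field; rewrite z0 Q0.
have -> : 2 * K * (N.+1%:R ^+ 3 * nc q ^+ N) = 2 * y * N.+1%:R ^+ 3 by rewrite /y; ring.
apply: (@le_trans _ _ (2 * y * N%:R ^+ 3)); last first.
  apply: ler_wpM2l; first by rewrite mulr_ge0.
  by rewrite lerXn2r ?nnegrE ?ler0n // ler_nat.
apply: (@sum_cubic_le N (fun s => (-1) ^+ s * A s * q ^+ s.+1 * u s)); first by rewrite mulr_ge0.
move=> s; rewrite !normcM [nc ((-1) ^+ s)]normcX normc_opp normc1 expr1n mul1r.
apply: (@le_trans _ _ (2 * s.+1%:R * nc q ^+ s * 1 * (s.+1%:R * (y / nc q ^+ s)))).
  apply: ler_pM; rewrite ?mulr_ge0 ?normc_ge0 //.
  apply: ler_pM; rewrite ?normc_ge0 //; first exact: theta_sum1_gap.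
  by rewrite normcX exprn_ile1 ?normc_ge0.
have q0 : nc q ^+ s != 0 by rewrite expf_neq0 // gt_eqF.
by move: (nc q ^+ s) q0 => z z0; rewrite le_eqVlt; apply/orP; left; apply/eqP; field.
Qed.

End HeckeSums.

(** * Regrouping block sums by exponent *)

Section BlockSeries.
Import Normc.
Variable R : realType.
Local Notation C := R[i].
Local Notation nc := (@Normc.normc R).

Lemma cvg_poly_geometric (K s : R) k : 0 <= K -> 0 <= s < 1 ->
  ((fun N => K * (N.+1%:R ^+ k * s ^+ N)) @ \oo --> (0 : R))%classic.
Proof.
move=> K0 s01; have [L [t [L0 t01 H]]] := poly_geometric k s01.
have /andP[s0 _] := s01.
apply: (squeeze_cvgr _ (cvg_cst 0) (cvg_bounded_geometric (K * L) t01)).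
near=> N; rewrite mulr_ge0 ?mulr_ge0 ?exprn_ge0 //=.
by rewrite -mulrA ler_wpM2l.
Unshelve. all: by end_near.
Qed.

Lemma sum_count_mem (x : C) (t : seq nat) N :
  \sum_(m < N) (count_mem (m : nat) t)%:R * x ^+ m = \sum_(k <- t | (k < N)%N) x ^+ k.
Proof.
elim: t => [|k t IH]; first by rewrite big_nil big1 // => m _; rewrite mul0r.
rewrite big_cons -IH; under eq_bigr => m _ do rewrite /= natrD mulrDl.
rewrite big_split /=; case: ifP => kN; last first.
  rewrite big1 ?add0r // => m _.
  by case: eqP => [km|_]; [rewrite km ltn_ord in kN | rewrite mul0r].
congr (_ + _); rewrite (bigD1 (Ordinal kN)) //= eqxx mul1r big1 ?addr0 // => m mk.
by case: eqP => [km|_]; [case/eqP: mk; apply: val_inj | rewrite mul0r].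
Qed.

(** Block s has only exponents >= s, so the N-th partial sums of the two series differ by exponents
    >= N from the first N blocks: at most 4N per block, hence O(N^2 |x|^N). *)
Lemma block_series (x : C) (b : nat -> seq nat) : nc x < 1 ->
  (forall s m, m \in b s -> (s <= m)%N) -> (forall s, (size (b s) <= 4 * s.+1)%N) ->
  exists S, csums (fun s => \sum_(m <- b s) x ^+ m) S /\
    csums (fun m => (\sum_(s < m.+1) count_mem m (b s))%:R * x ^+ m) S.
Proof.
move=> x1 bs sb; have x01 : 0 <= nc x < 1 by rewrite normc_ge0.
have tail N s (P : pred nat) : (forall m, m \in b s -> P m -> (N <= m)%N) ->
    nc (\sum_(m <- b s | P m) x ^+ m) <= 4 * s.+1%:R * nc x ^+ N.
  move=> PN; rewrite big_seq_cond; apply: le_trans (normc_sum _ _ _) _.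
  apply: (@le_trans _ _ (\sum_(m <- b s) nc x ^+ N)).
    rewrite [leRHS](bigID (fun m => (m \in b s) && P m)) /= -[leLHS]addr0.
    apply: lerD; last by rewrite sumr_ge0 // => *; rewrite exprn_ge0 ?normc_ge0.
    apply: ler_sum => m /andP[mb Pm]; rewrite normcX ler_wiXn2l ?normc_ge0 ?ltW //.
    exact: PN.
  rewrite big_const_seq count_predT iter_addr_0 -[leLHS]mulr_natl.
  apply: ler_wpM2r; first by rewrite exprn_ge0 ?normc_ge0.
  by rewrite -natrM ler_nat.
have [K [t [K0 t01 HK]]] := poly_geometric 1 x01.
have [|S HS] := @csums_exists R (fun s => \sum_(m <- b s) x ^+ m) (4 * K) t t01.
  move=> s; apply: le_trans (tail s s _ _) _; first by move=> m mb _; exact: bs.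
  by rewrite -!mulrA ler_wpM2l // -[s.+1%:R]expr1.
exists S; split => //.
apply: (@cconv_near R _ (fun N => \sum_(s < N) \sum_(m <- b s) x ^+ m) S
  (fun N => 4 * (N.+1%:R ^+ 2 * nc x ^+ N))) => //; last exact: cvg_poly_geometric.
move=> N; rewrite -normc_opp opprB.
have -> : \sum_(n < N) (\sum_(s < n.+1) count_mem (n : nat) (b s))%:R * x ^+ n =
    \sum_(s < N) \sum_(m <- b s | (m < N)%N) x ^+ m.
  under [RHS]eq_bigr => s _ do rewrite -sum_count_mem.
  rewrite exchange_big; apply: eq_bigr => -[m mN] _ /=.
  rewrite natr_sum mulr_suml.
  rewrite -(big_mkord predT (fun s => (count_mem m (b s))%:R * x ^+ m)).
  rewrite -(big_mkord predT (fun s => (count_mem m (b s))%:R * x ^+ m)).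
  rewrite [RHS](big_cat_nat (n := m.+1)) //= [X in _ = _ + X]big_nat_cond.
  rewrite [X in _ = _ + X]big1 ?addr0 // => s /andP[/andP[ms _] _].
  suff -> : count_mem m (b s) = 0%N by rewrite mul0r.
  by apply/count_memPn/negP => /bs; rewrite leqNgt ms.
rewrite -sumrB (eq_bigr (fun s : 'I_N => \sum_(m <- b s | ~~ (m < N)%N) x ^+ m)); last first.
  by move=> s _; rewrite (bigID (fun m => (m < N)%N)) /= addrAC subrr add0r.
apply: le_trans (normc_sum _ _ _) _.
apply: (@le_trans _ _ (\sum_(s < N) 4 * N.+1%:R * nc x ^+ N)).
  apply: ler_sum => -[s sN] _ /=; apply: le_trans (tail N s _ _) _.
    by move=> m _; rewrite -leqNgt.
  apply: ler_wpM2r; first by rewrite exprn_ge0 ?normc_ge0.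
  by rewrite ler_wpM2l // ler_nat ltnS ltnW.
rewrite sumr_const card_ord -[leLHS]mulr_natl expr2.
have -> : 4 * (N.+1%:R * N.+1%:R * nc x ^+ N) = N.+1%:R * (4 * N.+1%:R * nc x ^+ N) by ring.
apply: ler_wpM2r; last by rewrite ler_nat.
by rewrite !mulr_ge0 ?exprn_ge0 ?normc_ge0.
Qed.

Lemma mem_norm_block7 s n : n \in norm_block7 s ->
  exists2 i, (i < s.*2.+2)%N & n = (24 * s.+1 ^ 2 - i.*2.+1 ^ 2)%N.
Proof. by case/mapP => i; rewrite mem_iota => hi ->; exists i. Qed.

Lemma mem_norm_block5 s n : n \in norm_block5 s -> exists u i,
  [/\ u = (3 * s).+1 \/ u = (3 * s).+2, (i < s.*2.+1)%N & n = (8 * u ^ 2 - 3 * i.*2.+1 ^ 2)%N].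
Proof.
case/allpairsP => -[u i] []; rewrite mem_iota !inE => /orP /= hu hi ->.
by exists u, i; split => //; case: hu => /eqP; [left|right].
Qed.

Lemma ideal_series (q : C) (m r d : nat) (b : nat -> seq nat) : nc q < 1 ->
  (forall s n, n \in b s -> (s <= n)%N) -> (forall s, (size (b s) <= 4 * s.+1)%N) ->
  (forall n, (n %% m = r %% m)%N -> num_ideals n = (2 * \sum_(s < n.+1) count_mem n (b s))%N) ->
  exists S, csums (fun s => \sum_(n <- b s | (n %% m == r %% m)%N) q ^+ n) S /\
    ideal_sum_is m r q (2 * S).
Proof.
move=> q1 bs sb H.
pose b' s := [seq n <- b s | (n %% m == r %% m)%N].
have [||S [S1 S2]] := @block_series q b' q1.
- by move=> s n; rewrite mem_filter => /andP[_ /bs].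
- by move=> s; apply: leq_trans (sb s); rewrite size_filter count_size.
exists S; split.
  have -> // : (fun s => \sum_(n <- b s | (n %% m == r %% m)%N) q ^+ n) =
    (fun s => \sum_(n <- b' s) q ^+ n).
  by apply/funext => s; rewrite big_filter.
rewrite /ideal_sum_is /csums.
have -> : (fun N => \sum_(n < N) (ideal_coef m r n)%:R * q ^+ n) =
  (fun N => 2 * \sum_(n < N) (\sum_(s < n.+1) count_mem (n : nat) (b' s))%:R * q ^+ n).
  apply/funext => N; rewrite mulr_sumr; apply: eq_bigr => n _ /=.
  rewrite mulrA -natrM; congr (_%:R * _); rewrite /ideal_coef; case: eqP => nm.
    rewrite H //; congr muln; apply: eq_bigr => s _; rewrite count_filter.
    apply: eq_count => k /=; case: eqP => [->|//].
    by rewrite nm eqxx.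
  rewrite big1 ?muln0 // => s _; rewrite count_filter.
  apply/eqP; rewrite -leqn0 leqNgt -has_count; apply/hasPn => k _ /=.
  by apply/negP => /andP[/eqP-> /eqP].
exact: cconvZ.
Qed.

End BlockSeries.

(** * The double sums as ideal generating functions *)

Section Assembly.
Import Normc.
Variable R : realType.
Local Notation C := R[i].
Local Notation nc := (@Normc.normc R).

Lemma csums_scale (c : C) (u v : nat -> C) l :
  (forall n, v n = c * u n) -> csums u l -> csums v (c * l).
Proof.
move=> vE ul; rewrite /csums.
have -> : (fun N => \sum_(n < N) v n) = (fun N => c * \sum_(n < N) u n).
  by apply/funext => N; rewrite mulr_sumr; apply: eq_bigr => n _; exact: vE.
exact: cconvZ.
Qed.

Lemma csums_ext (u v : nat -> C) l : u =1 v -> csums u l -> csums v l.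
Proof. by move=> /funext ->. Qed.

Lemma cstarsums_ext (u v : nat -> C) l : u =1 v -> cstarsums u l -> cstarsums v l.
Proof. by move=> /funext ->. Qed.

Lemma qpochE (a q : C) n : qpoch a q n = qprod a q n.
Proof. by []. Qed.

Lemma csums_double_sum1 (p c d l : C) : nc p < 1 -> p != 0 ->
  csums (fun s => c * theta_sum1 p s + d * theta_sum1 (- p) s) l ->
  csums (fun n => c * double_sum_term p 1 n + d * double_sum_term (- p) 1 n) l.
Proof.
move=> p1 p0 Hl.
have p1' : nc (- p) < 1 by rewrite normc_opp.
have p0' : - p != 0 by rewrite oppr_eq0.
have [K K0 HK] := double_sum1_error p1 p0; have [L L0 HL] := double_sum1_error p1' p0'.
have q01 : 0 <= nc (p ^+ 2) < 1 by rewrite normc_ge0 normcX_lt1.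
have M0 : 0 <= nc c * K + nc d * L by rewrite addr_ge0 ?mulr_ge0 ?normc_ge0.
apply: (cconv_near Hl _ (cvg_poly_geometric 3 M0 q01)) => N.
rewrite !big_split /= -!mulr_sumr opprD addrACA -!mulrBr mulrDl -(mulrA (nc c)) -(mulrA (nc d)).
apply: le_trans (normcD _ _) _; rewrite (normcM c) (normcM d); apply: lerD.
  by apply: ler_wpM2l; [exact: normc_ge0 | exact: HK].
by apply: ler_wpM2l; [exact: normc_ge0 | rewrite -[p ^+ 2]sqrrN; exact: HL].
Qed.

Lemma cstarsums_double_sum0 (p c d l : C) : nc p < 1 -> p != 0 ->
  csums (fun s => c * theta_sum0 p s + d * theta_sum0 (- p) s) l ->
  cstarsums (fun n => c * double_sum_term p 0 n + d * double_sum_term (- p) 0 n) (l / 2).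
Proof.
move=> p1 p0 Hl.
have p1' : nc (- p) < 1 by rewrite normc_opp.
have p0' : - p != 0 by rewrite oppr_eq0.
have [K K0 HK] := double_sum0_error p1 p0; have [L L0 HL] := double_sum0_error p1' p0'.
have q01 : 0 <= nc (p ^+ 2) < 1 by rewrite normc_ge0 normcX_lt1.
have M0 : 0 <= nc c * K + nc d * L by rewrite addr_ge0 ?mulr_ge0 ?normc_ge0.
pose P N := \sum_(n < N) (c * double_sum_term p 0 n + d * double_sum_term (- p) 0 n).
pose Q N := \sum_(s < N) (c * theta_sum0 p s + d * theta_sum0 (- p) s).
have near N : nc (P N + P N.+1 - Q N.+1) <=
    (nc c * K + nc d * L) * (N.+1%:R ^+ 3 * nc (p ^+ 2) ^+ N).
  have -> : P N + P N.+1 - Q N.+1 =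
    c * (\sum_(n < N) double_sum_term p 0 n + \sum_(n < N.+1) double_sum_term p 0 n -
      \sum_(s < N.+1) theta_sum0 p s) +
    d * (\sum_(n < N) double_sum_term (- p) 0 n + \sum_(n < N.+1) double_sum_term (- p) 0 n -
      \sum_(s < N.+1) theta_sum0 (- p) s).
    by rewrite /P /Q !big_split /= -!mulr_sumr; ring.
  rewrite mulrDl -(mulrA (nc c)) -(mulrA (nc d)).
  apply: le_trans (normcD _ _) _; rewrite (normcM c) (normcM d); apply: lerD.
    by apply: ler_wpM2l; [exact: normc_ge0 | exact: HK].
  by apply: ler_wpM2l; [exact: normc_ge0 | rewrite -[p ^+ 2]sqrrN; exact: HL].
(* The error estimate compares P N + P (N+1) with Q (N+1); the starred sum then takes the cutoffs
   2N+1. *)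
have QS := cconv_subseq (h := S) (fun N => leqnSn N) Hl.
have h2 N : (N <= N.*2.+1)%N by lia.
have := cconv_subseq h2 (cconv_near QS near (cvg_poly_geometric 3 M0 q01)).
move=> /(cconvZ (2^-1)); rewrite [2^-1 * l]mulrC.
by congr (cconv _ _); apply/funext => N; rewrite mulrC.
Qed.

Lemma cstarsums_delta (u : nat -> C) l : cstarsums u l ->
  cstarsums (fun n => (n == 0%N)%:R + u n) (1 + l).
Proof.
move=> ul; rewrite /cstarsums.
have -> : (fun N => (\sum_(n < N.*2.+1) ((n == 0%N :> nat)%:R + u n) +
      \sum_(n < N.*2.+2) ((n == 0%N :> nat)%:R + u n)) / 2) =
    (fun N => 1 + (\sum_(n < N.*2.+1) u n + \sum_(n < N.*2.+2) u n) / 2).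
  apply/funext => N.
  have delta1 M : \sum_(n < M.+1) (n == 0%N :> nat)%:R = 1 :> C.
    by rewrite big_ord_recl big1 ?addr0.
  by rewrite !big_split /= !delta1; field.
by apply: cconvD => //; exact: cconv_cst.
Qed.

(** (-1; q)_(n+1) = 2 (-q; q)_n, and (-q; q)_n (q; q)_n = (q^2; q^2)_n. *)
Lemma qprodN1 (q : C) n : qprod (-1) q n.+1 * qprod q q n = 2 * even_qfact q n.
Proof.
elim: n => [|n IH].
  by rewrite /even_qfact !qprodS !qprod0 expr0; ring.
rewrite qprodS qfactS even_qfactS.
have -> : qprod (-1) q n.+1 * (1 - -1 * q ^+ n.+1) * (qprod q q n * (1 - q ^+ n.+1)) =
   (qprod (-1) q n.+1 * qprod q q n) * (1 - q ^+ n.+1 ^+ 2) by ring.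
by rewrite IH mulrA.
Qed.

Section Terms.
Variables (p : C).
Hypothesis p_lt1 : nc p < 1.
Local Notation q := (p ^+ 2).

Let q_neq1 k : 1 - q ^+ k.+1 != 0. Proof. by rewrite one_sub_expr_neq0 // normcX_lt1. Qed.

(** Replacing p by -p fixes q and negates X = p^(2l+1). Over 1 - X^2 = 1 - q^(2l+1) the numerator is
    2c for d = c and 2cX for d = -c. *)
Lemma double_sum_termB e n (c d : C) :
  c * double_sum_term p e n + d * double_sum_term (- p) e n =
  \sum_(l < n.+1) (- q ^+ e) ^+ n * even_qfact q n * (-1) ^+ l * q ^+ 'C(l.+1, 2) *
    (c * (1 + p ^+ l.*2.+1) + d * (1 - p ^+ l.*2.+1)) /
    (qprod q q (n - l) * qprod q q l * (1 - q ^+ l.*2.+1)).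
Proof.
rewrite /double_sum_term sqrrN !mulr_sumr -big_split; apply: eq_bigr => -[l ln] _ /=.
have p1' : nc (- p) < 1 by rewrite normc_opp.
have h1 := one_sub_expr_neq0 l.*2 p_lt1; have h2 := one_sub_expr_neq0 l.*2 p1'.
have eN : (- p) ^+ l.*2.+1 = - p ^+ l.*2.+1 by rewrite exprNn -signr_odd /= odd_double /= expr1 mulN1r.
have h3 := qfact_neq0 q_neq1 (n - l); have h4 := qfact_neq0 q_neq1 l.
rewrite /bailey_beta_coef inv_qfactE // eN (exprAC p 2 l.*2.+1).
rewrite eN opprK in h2.
have h5 : 1 - p ^+ l.*2.+1 ^+ 2 != 0 by rewrite exprAC.
move: (p ^+ l.*2.+1) h1 h2 h5 => X h1 h2 h5.
move: (qprod _ _ _) (qprod _ _ l) h3 h4 (even_qfact _ _) (q ^+ 'C(_, 2)) ((- q ^+ e) ^+ n).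
move=> F G F0 G0 E T Z.
by field; rewrite h5 G0 F0 opprK h2 h1.
Qed.

Lemma term910E (e : nat -> nat) n : term910 e q n.+1 =
  \sum_(l < n.+1) 2 * even_qfact q n * (-1) ^+ n * (-1) ^+ l * q ^+ (n.+1 + e l.+1) /
    (qprod q q (n - l) * qprod q q l * (1 - q ^+ l.*2.+1)).
Proof.
rewrite /term910 big_add1 big_mkord; apply: eq_bigr => -[l ln] _; rewrite [nat_of_ord _]/=.
have -> : (2 * l.+1).-1 = l.*2.+1 by lia.
have -> : (-1) ^+ (n.+1 + l.+1) = (-1) ^+ n * (-1) ^+ l :> C.
  by rewrite addnS addSn !exprS !mulN1r opprK exprD.
by rewrite subSS !qpochE qprodN1 !mulrA.
Qed.

(** The surplus over q^n q^C(l+1,2) is q^(l+2) = p^3 X with X = p^(2l+1), hence the odd part; for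
    L_10 it is q^2 = p^4, hence the even part. *)
Lemma term9E n : term910 (fun k => 'C(k.+1, 2)) q n.+1 =
  p ^+ 3 * double_sum_term p 1 n + - p ^+ 3 * double_sum_term (- p) 1 n.
Proof.
rewrite term910E double_sum_termB; apply: eq_bigr => l _; congr (_ / _).
have -> : q ^+ (n.+1 + 'C(l.+2, 2)) = q ^+ n * q ^+ 'C(l.+1, 2) * (p ^+ 3 * p ^+ l.*2.+1).
  rewrite -exprD -[p ^+ _ * p ^+ _]exprD -!exprM -exprD; congr (_ ^+ _).
  by rewrite binS bin1; lia.
rewrite expr1 [(- q) ^+ n]exprNn; ring.
Qed.

Lemma term10E n : q * term910 (fun k => 'C(k, 2)) q n.+1 =
  p ^+ 4 * double_sum_term p 1 n + p ^+ 4 * double_sum_term (- p) 1 n.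
Proof.
rewrite term910E double_sum_termB mulr_sumr; apply: eq_bigr => l _.
rewrite mulrA; congr (_ / _).
have -> : q ^+ (n.+1 + 'C(l.+1, 2)) = q ^+ n * q ^+ 'C(l.+1, 2) * q.
  by rewrite addSn exprSr exprD.
rewrite expr1 [(- q) ^+ n]exprNn; ring.
Qed.

Lemma term1112E (e : nat -> nat) n : term1112 e q n =
  \sum_(l < n.+1) even_qfact q n * (-1) ^+ n * (-1) ^+ l * q ^+ e l /
    (qprod q q (n - l) * qprod q q l * (1 - q ^+ l.*2.+1)).
Proof.
rewrite /term1112 big_mkord; apply: eq_bigr => l _.
by rewrite !qpochE mul2n exprD mulrA.
Qed.

Lemma term11E n : term1112 (fun k => 'C(k.+1, 2)) q n =
  2^-1 * double_sum_term p 0 n + 2^-1 * double_sum_term (- p) 0 n.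
Proof.
rewrite term1112E double_sum_termB; apply: eq_bigr => l _; congr (_ / _).
by rewrite expr0; field.
Qed.

(** Write 1 / (1 - Y) = 1 + Y / (1 - Y) with Y = q^(2l+1). The 1 sums to the delta by
    [finite_euler]; in the rest q^C(l,2) Y = q^C(l+1,2) p X with X = p^(2l+1), an odd part. *)
Lemma term12E n : term1112 (fun k => 'C(k, 2)) q n =
  (n == 0%N)%:R + (p / 2 * double_sum_term p 0 n + - (p / 2) * double_sum_term (- p) 0 n).
Proof.
rewrite term1112E double_sum_termB -(finite_euler q_neq1).
have -> : \sum_(l < n.+1) (-1) ^+ l * q ^+ 'C(l, 2) / qprod q q l * inv_qfact q n l =
  \sum_(l < n.+1) even_qfact q n * (-1) ^+ n *
    ((-1) ^+ l * q ^+ 'C(l, 2) / qprod q q l * inv_qfact q n l).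
  rewrite -mulr_sumr (finite_euler q_neq1); case: n => [|n] /=; last by rewrite mulr0.
  by rewrite /even_qfact qprod0 expr0 !mulr1.
rewrite -big_split; apply: eq_bigr => -[l ln] _ /=.
have h3 := qfact_neq0 q_neq1 (n - l); have h4 := qfact_neq0 q_neq1 l.
have h5 := q_neq1 l.*2.
rewrite inv_qfactE // binS bin1 exprD expr0.
have e1 : q ^+ l.*2.+1 = q ^+ l * (p * p ^+ l.*2.+1).
  by rewrite -exprS -!exprM -exprD; congr (_ ^+ _); lia.
have e2 : p ^+ l.*2.+1 = p * q ^+ l by rewrite exprS -exprM mul2n.
rewrite e2 in e1 *; rewrite e1 in h5 *.
move: (qprod _ _ _) (qprod _ _ l) (q ^+ l) h3 h4 h5 => F G z F0 G0 h5.
by field; rewrite h5 F0 G0.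
Qed.

End Terms.
Lemma sum_map_iota (x : C) (N : nat -> nat) (P : pred nat) K :
  \sum_(n <- [seq N i | i <- iota 0 K.+1] | P n) x ^+ n =
  \sum_(i < K.+1) if P (N i) then x ^+ N i else 0.
Proof. by rewrite big_mkcond big_map -[iota 0 _]/(index_iota 0 K.+1) big_mkord. Qed.

Lemma signed_powB (y : C) a : y ^+ a - (- y) ^+ a = if odd a then 2 * y ^+ a else 0.
Proof.
rewrite exprNn -signr_odd; case: (odd a); last by rewrite expr0 mul1r subrr.
by rewrite expr1 mulN1r opprK mulr2n mulrDl mul1r.
Qed.

Lemma signed_powD (y : C) a : y ^+ a + (- y) ^+ a = if odd a then 0 else 2 * y ^+ a.
Proof.
rewrite exprNn -signr_odd; case: (odd a); first by rewrite expr1 mulN1r subrr.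
by rewrite expr0 mulr2n mulrDl mul1r.
Qed.

(** * Theta blocks as sums over norms *)

Section Blocks.
Variable x : C.

(** Completing the square by (2i+1)^2 = 8 C(i+1,2) + 1; the factor 8, and 24 in the next lemma,
    dictates p = x^8 and p = x^24. *)
Lemma norm_exponent7 s i : (i < s.*2.+2)%N ->
  (24 * s.+1 ^ 2 - i.*2.+1 ^ 2 = 8 * (3 * s ^ 2 + 6 * s + 1 - 'C(i.+1, 2)) + 15)%N.
Proof.
move=> iM; have := leq_bin2l 2 iM; have := bin2D s.*2.+2; have := bin2D i.+1.
by move: 'C(i.+1, 2) 'C(s.*2.+2, 2) => u v; nia.
Qed.

Lemma norm_exponent5 s i : (i < s.*2.+1)%N ->
  (8 * (3 * s).+1 ^ 2 - 3 * i.*2.+1 ^ 2 = 24 * (3 * s ^ 2 + 2 * s - 'C(i.+1, 2)) + 5)%N /\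
  (8 * (3 * s).+2 ^ 2 - 3 * i.*2.+1 ^ 2 = 24 * (3 * s ^ 2 + 4 * s + 1 - 'C(i.+1, 2)) + 5)%N.
Proof.
move=> iM; have := leq_bin2l 2 iM; have := bin2D s.*2.+1; have := bin2D i.+1.
by move: 'C(i.+1, 2) 'C(s.*2.+1, 2) => u v; split; nia.
Qed.

(** The odd part keeps the odd exponents a, that is 8a + 15 = 7 mod 16, and x^24 = x^9 x^15 explains
    the prefactor. The other three blocks follow the same pattern. *)
Lemma theta_block7 s :
  x ^+ 8 ^+ 3 * theta_sum1 (x ^+ 8) s + - x ^+ 8 ^+ 3 * theta_sum1 (- x ^+ 8) s =
  2 * x ^+ 9 * \sum_(n <- norm_block7 s | (n %% 16 == 7 %% 16)%N) x ^+ n.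
Proof.
rewrite /norm_block7 sum_map_iota /theta_sum1 mulNr -mulrBr -sumrB !mulr_sumr.
apply: eq_bigr => -[i iM] _ /=; rewrite signed_powB norm_exponent7 //.
set a := (_ - _)%N; have -> : ((8 * a + 15) %% 16 == 7)%N = odd a by lia.
case: ifP => _; last by rewrite !mulr0.
by rewrite mulrCA -exprD -exprM -mulrA -exprD; congr (_ * x ^+ _); lia.
Qed.

Lemma theta_block15 s :
  x ^+ 8 ^+ 4 * theta_sum1 (x ^+ 8) s + x ^+ 8 ^+ 4 * theta_sum1 (- x ^+ 8) s =
  2 * x ^+ 17 * \sum_(n <- norm_block7 s | (n %% 16 == 15 %% 16)%N) x ^+ n.
Proof.
rewrite /norm_block7 sum_map_iota /theta_sum1 -mulrDr -big_split !mulr_sumr.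
apply: eq_bigr => -[i iM] _ /=; rewrite signed_powD norm_exponent7 //.
set a := (_ - _)%N; have -> : ((8 * a + 15) %% 16 == 15)%N = ~~ odd a by lia.
case: odd; first by rewrite !mulr0.
by rewrite mulrCA -exprD -exprM -mulrA -exprD; congr (_ * x ^+ _); lia.
Qed.

Lemma sum_norm_block5 (P : pred nat) s : \sum_(n <- norm_block5 s | P n) x ^+ n =
  \sum_(i < s.*2.+1)
    ((if P (24 * (3 * s ^ 2 + 2 * s - 'C(i.+1, 2)) + 5)%N
      then x ^+ (24 * (3 * s ^ 2 + 2 * s - 'C(i.+1, 2)) + 5) else 0) +
     (if P (24 * (3 * s ^ 2 + 4 * s + 1 - 'C(i.+1, 2)) + 5)%N
      then x ^+ (24 * (3 * s ^ 2 + 4 * s + 1 - 'C(i.+1, 2)) + 5) else 0)).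
Proof.
rewrite /norm_block5 big_mkcond big_allpairs_dep big_cons big_seq1.
rewrite -[iota 0 _]/(index_iota 0 s.*2.+1) !big_mkord [RHS]big_split /=; congr (_ + _);
  by apply: eq_bigr => -[i iM] _ /=; have [E1 E2] := norm_exponent5 iM; rewrite ?E1 ?E2.
Qed.

Let parity48 a : ((24 * a + 5) %% 48 == 5)%N = ~~ odd a /\
  ((24 * a + 5) %% 48 == 29)%N = odd a.
Proof. by split; lia. Qed.

Lemma theta_block5 s :
  x ^+ 5 * (2^-1 * theta_sum0 (x ^+ 24) s + 2^-1 * theta_sum0 (- x ^+ 24) s) =
  \sum_(n <- norm_block5 s | (n %% 48 == 5 %% 48)%N) x ^+ n.
Proof.
rewrite sum_norm_block5 /theta_sum0 -mulrDr -big_split !mulr_sumr.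
apply: eq_bigr => -[i iM] _ /=; rewrite addrACA !signed_powD !(parity48 _).1.
have two : (2 : C) != 0 by rewrite pnatr_eq0.
rewrite !mulrDr; congr (_ + _); set a := (_ - _)%N.
  case: odd; first by rewrite !mulr0.
  by rewrite mulKf // -exprM -exprD; congr (x ^+ _); lia.
case: odd; first by rewrite !mulr0.
by rewrite mulKf // -exprM -exprD; congr (x ^+ _); lia.
Qed.

Lemma theta_block29 s :
  x ^+ 24 / 2 * theta_sum0 (x ^+ 24) s + - (x ^+ 24 / 2) * theta_sum0 (- x ^+ 24) s =
  x ^+ 19 * \sum_(n <- norm_block5 s | (n %% 48 == 29 %% 48)%N) x ^+ n.
Proof.
rewrite sum_norm_block5 /theta_sum0 mulNr -mulrBr -sumrB !mulr_sumr.
apply: eq_bigr => -[i iM] _ /=; rewrite opprD addrACA !signed_powB !(parity48 _).2.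
have two : (2 : C) != 0 by rewrite pnatr_eq0.
rewrite !mulrDr; congr (_ + _); set a := (_ - _)%N.
  case: odd; last by rewrite !mulr0.
  by rewrite mulrA mulfVK // -exprM -!exprD; congr (x ^+ _); lia.
case: odd; last by rewrite !mulr0.
by rewrite mulrA mulfVK // -exprM -!exprD; congr (x ^+ _); lia.
Qed.

End Blocks.
End Assembly.

Lemma norm_block7_le s n : n \in norm_block7 s -> (s <= n)%N.
Proof. by move=> /mem_norm_block7[i iM ->]; nia. Qed.

Lemma norm_block5_le s n : n \in norm_block5 s -> (s <= n)%N.
Proof. by move=> /mem_norm_block5[u [i [[] -> iM ->]]]; nia. Qed.

Lemma size_norm_block7 s : (size (norm_block7 s) <= 4 * s.+1)%N.
Proof. by rewrite size_map size_iota; lia. Qed.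

Lemma size_norm_block5 s : (size (norm_block5 s) <= 4 * s.+1)%N.
Proof. by rewrite size_allpairs size_iota /=; lia. Qed.

Unset Implicit Arguments.

Theorem theorem1p3 (R : realType) (q : R[i]) :
  Normc.normc q < 1 -> q != 0 ->
  (exists l S, L9_is (q ^+ 16) l /\ ideal_sum_is 16 7 q S /\ q ^- 9 * l = S) /\
  (exists l S, L10_is (q ^+ 16) l /\ ideal_sum_is 16 15 q S /\ q ^- 17 * l = S) /\
  (exists l S, L11_is (q ^+ 48) l /\ ideal_sum_is 48 5 q S /\ q ^+ 5 * l = S / 2) /\
  (exists l S, L12_is (q ^+ 48) l /\ ideal_sum_is 48 29 q S /\ q ^- 19 * l = S / 2).
Proof.
move=> q1 q0.
have p8 := normcX_lt1 7 q1; have p24 := normcX_lt1 23 q1.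
have p8_0 : q ^+ 8 != 0 by rewrite expf_neq0.
have p24_0 : q ^+ 24 != 0 by rewrite expf_neq0.
have q16 : q ^+ 16 = q ^+ 8 ^+ 2 by rewrite -exprM.
have q48 : q ^+ 48 = q ^+ 24 ^+ 2 by rewrite -exprM.
have series7 r : (forall n, n %% 16 = r %% 16 -> n %% 8 = 7)%N -> exists S,
    csums (fun s => \sum_(n <- norm_block7 s | (n %% 16 == r %% 16)%N) q ^+ n) S /\
    ideal_sum_is 16 r q (2 * S).
  move=> Hr; apply: ideal_series => // [|s|n /Hr]; [exact: norm_block7_le | exact: size_norm_block7 |].
  exact: num_ideals7.
have series5 r : (forall n, n %% 48 = r %% 48 -> n %% 24 = 5)%N -> exists S,
    csums (fun s => \sum_(n <- norm_block5 s | (n %% 48 == r %% 48)%N) q ^+ n) S /\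
    ideal_sum_is 48 r q (2 * S).
  move=> Hr; apply: ideal_series => // [|s|n /Hr]; [exact: norm_block5_le | exact: size_norm_block5 |].
  exact: num_ideals5.
split; [|split; [|split]].
- have [|S [S1 S2]] := series7 7%N; first by move=> n; lia.
  exists (2 * q ^+ 9 * S), (2 * S); split; last first.
    by split => //; field; rewrite q0.
  rewrite /L9_is q16; apply: (csums_ext (fun n => esym (term9E p8 n))).
  apply: csums_double_sum1 => //; apply: csums_scale S1 => s; exact: theta_block7.
- have [|S [S1 S2]] := series7 15%N; first by move=> n; lia.
  exists (2 * q ^+ 17 * S), (2 * S); split; last first.
    by split => //; field; rewrite q0.
  (* L_10 carries an outer factor q, here q^16, which is divided out to get the bare double sum. *)
  exists (q ^- 16 * (2 * q ^+ 17 * S)); split; last by rewrite mulVKf // expf_neq0.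
  rewrite q16; apply: (csums_scale (u := fun n =>
    q ^+ 8 ^+ 4 * double_sum_term (q ^+ 8) 1 n + q ^+ 8 ^+ 4 * double_sum_term (- q ^+ 8) 1 n)).
    by move=> n; rewrite -(term10E p8) mulKf // expf_neq0.
  apply: csums_double_sum1 => //; apply: csums_scale S1 => s; exact: theta_block15.
- have [|S [S1 S2]] := series5 5%N; first by move=> n; lia.
  exists (q ^- 5 * S), (2 * S); split; last first.
    by split => //; field; rewrite q0.
  exists (q ^- 5 * S / 2); split; last by field.
  rewrite q48; apply: (cstarsums_ext (fun n => esym (term11E p24 n))).
  apply: cstarsums_double_sum0 => //; apply: csums_scale S1 => s.
  by rewrite -theta_block5 mulKf // expf_neq0.
- have [|S [S1 S2]] := series5 29%N; first by move=> n; lia.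
  exists (q ^+ 19 * S), (2 * S); split; last first.
    by split => //; field; rewrite q0.
  (* The 1 is the delta of [term12E]; doubled, it cancels the -2 of L_12. *)
  exists (1 + q ^+ 19 * S / 2); split; last by field.
  rewrite q48; apply: (cstarsums_ext (fun n => esym (term12E p24 n))).
  apply: cstarsums_delta; apply: cstarsums_double_sum0 => //.
  apply: csums_scale S1 => s; exact: theta_block29.
Qed.
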